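(* Consider the perturbed mechanical system $$\dot q=\nabla_{\mathbf p}H(q,\mathbf p),\qquad \dot{\mathbf p}=-\nabla_q H(q,\mathbf p)-\mathfrak R\,\nabla_{\mathbf p}H(q,\mathbf p)+G(q)u+d,\qquad H(q,\mathbf p)=\tfrac12\mathbf p^\top M^{-1}(q)\mathbf p+V(q),$$ with $q,\mathbf p\in\mathbb R^n$, $u\in\mathbb R^m$, known friction matrix $\mathfrak R=\mathrm{diag}\{r_1,\dots,r_n\}$, $r_i\ge0$, and unknown constant disturbance $d\in\mathbb R^n$. There exist smooth mappings $$\mathbf A:\mathbb R^{4n}\times\mathbb R_{\ge0}\times\mathbb R^n\times\mathbb R^m\to\mathbb R^{4n+1},\qquad \mathbf B:\mathbb R^{4n}\times\mathbb R_{\ge0}\times\mathbb R^n\to\mathbb R^n,$$ not depending on $d$, such that the interconnection of the system with $$\dot{\mathrm X}=\mathbf A(\mathrm X,q,u),\qquad \hat{\mathbf p}=\mathbf B(\mathrm X,q),$$ where $\mathrm X\in\mathbb R^{4n}\times\mathbb R_{\ge0}$ and $\hat{\mathbf p}\in\mathbb R^n$, ensures, for every $d\in\mathbb R^n$, that $$\lim_{t\to\infty}\big[\hat{\mathbf p}(t)-\mathbf p(t)\big]=0$$ for all initial conditions $(q(0),\mathbf p(0),\mathrm X(0))\in\mathbb R^n\times\mathbb R^n\times\mathbb R^{4n}\times\mathbb R_{\ge0}$. That is, in spite of the unknown disturbance $d$, the dynamical system $\dot{\mathrm X}=\mathbf A(\mathrm X,q,u)$, $\hat{\mathbf p}=\mathbf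 B(\mathrm X,q)$ is a globally convergent momenta observer for the mechanical system with friction.
   Context: $M:\mathbb R^n\to\mathbb R^{n\times n}$ is the inertia matrix, $M(q)=M^\top(q)>0$ for all $q$; $V:\mathbb R^n\to\mathbb R$ is the potential energy; $G:\mathbb R^n\to\mathbb R^{n\times m}$ is the input matrix. $M,V,G$ are known and smooth, and $\mathbf A,\mathbf B$ may depend on $M,V,G,\mathfrak R$. The input $u(t)$ is assumed to be such that the trajectories of the system exist for all $t\ge0$. Here $\nabla_q$, $\nabla_{\mathbf p}$ denote (column) gradients with respect to $q$ and $\mathbf p$. *)

(* Defs.v *)
From HB Require Import structures.
From mathcomp Require Export all_boot all_order all_algebra.
From mathcomp Require Export all_classical all_reals all_analysis.
Set Implicit Arguments.
Unset Strict Implicit.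
Unset Printing Implicit Defensive.
Import Order.TTheory GRing.Theory Num.Theory.
Export numFieldNormedType.Exports.
Local Open Scope classical_set_scope.
Local Open Scope ring_scope.

(* For finite-dimensional V and open U this is the usual class C^k: f is
   differentiable on U and each of its directional derivatives is C^(k-1). *)
Fixpoint Ck (R : realType) (V W : normedModType R) (k : nat) (U : set V)
    (f : V -> W) : Prop :=
  if k is k'.+1 then
    (forall x, U x -> differentiable f x) /\
    (forall v : V, Ck k' U (fun x => 'D_v f x))
  else forall x, U x -> {for x, continuous f}.

(* Smoothness on a set D that need not be open (such as a closed half-space):
   f coincides on D with a C^oo map defined on an open neighbourhood of D.
   The values of f outside D are irrelevant. *)
Definition smooth_on (R : realType) (V W : normedModType R) (D : set V)
    (f : V -> W) : Prop :=
  exists (U : set V) (g : V -> W),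
    [/\ open U, D `<=` U, (forall k, Ck k U g) & (forall x, D x -> f x = g x)].

Definition grad (R : realType) (n : nat) (f : 'cV[R]_n -> R) (x : 'cV[R]_n) :
    'cV[R]_n :=
  \col_i 'D_(delta_mx i 0) f x.

Definition sym_posdef (R : realType) (n : nat) (P : 'M[R]_n) : Prop :=
  P^T = P /\ forall v : 'cV[R]_n, v != 0 -> 0 < (v^T *m P *m v) 0 0.

Definition hamiltonian (R : realType) (n : nat) (M : 'cV[R]_n -> 'M[R]_n)
    (V : 'cV[R]_n -> R) (q p : 'cV[R]_n) : R :=
  2^-1 * (p^T *m invmx (M q) *m p) 0 0 + V q.

(* Classical solution on [0, +oo[ of x' = f, where f t stands for the
   right-hand side evaluated along the trajectory; the derivative at time 0 is
   one-sided, and the values of x at negative times are irrelevant. *)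
Definition solves (R : realType) (W : normedModType R) (x f : R -> W) : Prop :=
  (h^-1 *: (x h - x 0) @[h --> 0^'+] --> f 0) /\
  (forall t : R, 0 < t -> is_derive t 1 x (f t)).

Definition mech_trajectory (R : realType) (n m : nat)
    (M : 'cV[R]_n -> 'M[R]_n) (V : 'cV[R]_n -> R) (G : 'cV[R]_n -> 'M[R]_(n, m))
    (r : 'rV[R]_n) (d : 'cV[R]_n) (u : R -> 'cV[R]_m) (q p : R -> 'cV[R]_n) :
    Prop :=
  let dHdq t := grad (fun z => hamiltonian M V z (p t)) (q t) in
  let dHdp t := grad (fun z => hamiltonian M V (q t) z) (p t) in
  solves q dHdp /\
  solves p (fun t => - dHdq t - diag_mx r *m dHdp t + G (q t) *m u t + d).

(* The observer state lives in R^(4n) x R_{>=0}, seen inside R^(4n) x R,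
   which is also the model of R^(4n+1) in which the vector field takes values. *)
Notation ostate R n := ('cV[R]_(4 * n) * R)%type.

Definition in_ostate (R : realType) (n : nat) (X : ostate R n) : Prop :=
  0 <= X.2.

Definition observer_trajectory (R : realType) (n m : nat)
    (A : ostate R n * 'cV[R]_n * 'cV[R]_m -> ostate R n)
    (q : R -> 'cV[R]_n) (u : R -> 'cV[R]_m) (X : R -> ostate R n) : Prop :=
  (forall t : R, 0 <= t -> in_ostate (X t)) /\ solves X (fun t => A (X t, q t, u t)).

(* Main.v *)
From HB Require Import structures.
Require Import Defs.
From mathcomp Require Import ring lra.
Set Implicit Arguments.
Unset Strict Implicit.
Unset Printing Implicit Defensive.
Import Order.TTheory GRing.Theory Num.Theory.
Local Open Scope classical_set_scope.
Local Open Scope ring_scope.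

(** In velocity coordinates [v = M^-1 p] the estimate is [vh = xi + g q], where
    the vector [xi] and the scalar gain [g] are functions of the observer state.
    As [q' = v], the error [w = vh - v] is damped by [- g w] although [v] is not
    measured.  With the quadratic terms written through Christoffel symbols, the
    energy [E = w^T M w / 2] satisfies
    [E' = - w^T (D_vh M) w / 2 - w^T R w - w^T d - 2 g E], where the only
    velocity is the known [vh]: it suffices that [g] dominate
    [al q (1 + |vh|^2)] for a suitable smooth weight [al].

    This target moves with the unknown [v], so one takes [g = k + rho^2], where
    the state [k] only tracks the target up to a gap [sg], and the gap is
    compensated by the scaling [rho' = rho (1 + sg^2)].  The function
    [E / rho + sg^2 / 2 + (|d|^2 / 2) exp (- t)] decreases at rate at least
    [sg^2], which is also the logarithmic derivative of [rho exp (- t)]: the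
    latter stays bounded, while [rho >= exp t].  The growing gain [rho^2] then
    drives [(1 + tr M) E], hence the momentum error [M w], to zero for every
    constant [d].

    In the variables [(w, sg, rho)] the arbitrary input [u] disappears from the
    observer equation, and the estimates above are the a priori bounds that make
    its solutions global. *)

(** * Smooth maps *)

(** No bound on [q], [p] or [M] along the motion is available, so the constants of the usual
    estimates become smooth functions of [q], with traces in place of the eigenvalues of [M] and
    [M^-1]. The weight [al] is a sum of prices: [n^2 + sumsq] for the velocity-dependent quadratic
    form, [mu = 1 + tr M] for [w^T d], and [1 + |grad mu|^2] for the drift of [mu] in the weighted
    energy [mu E]. Young's inequality with weight [mu] leaves [|d|^2 / (2 mu)], which is still
    bounded after multiplication by [mu].

    The law for [rho] comes from the gap: a gain off by [sg] costs [- 2 sg E <= (1 + sg^2) E], and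
    [1 + sg^2] is the logarithmic growth rate of [rho], so the cost disappears in [E / rho].
    Conversely, the derivative of the target of [k] is known up to a term linear in [w]; a feedback
    on [k] whose coefficient grows with [rho] reduces that term to [E / rho], which the damping
    [rho^2] absorbs. The loop between [E] and [sg] closes without any smallness condition. *)

Section smooth.
Context {R : realType}.
Implicit Types V W : normedModType R.

Definition smooth V W (f : V -> W) : Prop := forall k, Ck k setT f.

Lemma eq_Ck V W k (f g : V -> W) : g =1 f -> Ck k setT f -> Ck k setT g.
Proof. by move=> /funext ->. Qed.

Lemma Ck_differentiable V W k (f : V -> W) x : Ck k.+1 setT f -> differentiable f x.
Proof. by case=> + _; exact. Qed.

Lemma CkW V W k (f : V -> W) : Ck k.+1 setT f -> Ck k setT f.
Proof.
elim: k f => [|k IH] f [df Df]; first by move=> x _; exact/differentiable_continuous/df.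
by split=> // v; apply: IH; exact: Df.
Qed.

Lemma Ck_cst V W k (c : W) : Ck k setT (fun _ : V => c).
Proof.
elim: k c => [|k IH] c; first by move=> x _; exact: cst_continuous.
split=> [x _|v]; first exact: differentiable_cst.
by apply: eq_Ck (IH 0) => x; exact: derive_cst.
Qed.

Lemma CkD V W k (f g : V -> W) : Ck k setT f -> Ck k setT g ->
  Ck k setT (fun x => f x + g x).
Proof.
elim: k f g => [|k IH] f g; first by move=> fk gk x _; apply: cvgD; [exact: fk|exact: gk].
move=> [df Df] [dg Dg]; split=> [x _|v].
  by apply: differentiableD; [exact: df|exact: dg].
apply: eq_Ck (IH _ _ (Df v) (Dg v)) => x.
by rewrite -deriveD //; apply: diff_derivable; [exact: df|exact: dg].
Qed.

Lemma CkZl V W k (f : V -> R) (w : W) : Ck k setT f -> Ck k setT (fun x => f x *: w).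
Proof.
elim: k f => [|k IH] f; first by move=> fk x _; apply: cvgZr_tmp; exact: fk.
move=> [df Df]; split=> [x _|v].
  by apply: differentiableZl; exact: df.
apply: eq_Ck (IH _ (Df v)) => x.
rewrite !deriveE; [|exact: df|by apply: differentiableZl; exact: df].
by rewrite diffZl//; exact: df.
Qed.

Lemma CkM V k (f g : V -> R) : Ck k setT f -> Ck k setT g ->
  Ck k setT (fun x => f x * g x).
Proof.
elim: k f g => [|k IH] f g; first by move=> fk gk x _; apply: cvgM; [exact: fk|exact: gk].
move=> fk gk; have [[df Df] [dg Dg]] := (fk, gk); split=> [x _|v].
  by apply: differentiableM; [exact: df|exact: dg].
apply: (@eq_Ck _ _ _ (fun x => f x * 'D_v g x + g x * 'D_v f x)) => [x|]; last first.
  by apply: CkD; apply: IH; [exact: CkW fk|exact: Dg|exact: CkW gk|exact: Df].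
by rewrite deriveM //; apply: diff_derivable; [exact: df|exact: dg].
Qed.

Lemma CkN V k (f : V -> R) : Ck k setT f -> Ck k setT (fun x => - f x).
Proof.
move=> fk; apply: (@eq_Ck _ _ _ (fun x => -1 * f x)) => [x|]; first by rewrite mulN1r.
by apply: CkM => //; exact: Ck_cst.
Qed.

(** The derivative [- f' / f^2] is again a product involving [f^-1], so the induction on [k] keeps
    [f] fixed and feeds on the lower-order claim for [f^-1] itself. *)
Lemma CkV V k (f : V -> R) : (forall x, f x != 0) -> Ck k setT f ->
  Ck k setT (fun x => (f x)^-1).
Proof.
move=> f0; elim: k => [|k IH]; first by move=> fk x _; apply: cvgV; [exact: f0|exact: fk].
move=> fk; have [df Df] := fk; split=> [x _|v].
  by apply: differentiableV; [exact: df|exact: f0].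
apply: (@eq_Ck _ _ _ (fun x => - ((f x)^-1 * (f x)^-1 * 'D_v f x))) => [x|]; last first.
  by apply: CkN; apply: CkM (Df v); apply: CkM; exact/IH/CkW.
rewrite deriveV //; last by apply: diff_derivable; exact: df.
by rewrite /GRing.scale /= expr2 invfM mulNr.
Qed.

(** For a linear inner map, the derivative of [f o L] along [v] is the derivative of [f] along
    [L v], again composed with [L], so the induction stays in the same class. This covers the
    observer, where [M], [V], [G] and their derivatives are evaluated at a projection of the
    arguments. *)
Lemma Ck_comp V V' W k (L : {linear V -> V'}) (f : V' -> W) : continuous L ->
  Ck k setT f -> Ck k setT (fun x => f (L x)).
Proof.
move=> cL; elim: k f => [|k IH] f.
  by move=> fk x _; apply: (@continuous_comp _ _ _ L f); [exact: cL|exact: fk].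
move=> [df Df].
have dfL x : differentiable (f \o L) x.
  by apply: differentiable_comp; [exact: linear_differentiable|exact: df].
split=> [x _|v]; first exact: dfL.
apply: eq_Ck (IH _ (Df (L v))) => x.
rewrite !deriveE; [|exact: df|exact: dfL].
rewrite diff_comp /=; [|exact: linear_differentiable|exact: df].
by rewrite diff_lin.
Qed.

Lemma Ck_post V W W' k (L : {linear W -> W'}) (f : V -> W) : continuous L ->
  Ck k setT f -> Ck k setT (fun x => L (f x)).
Proof.
move=> cL; elim: k f => [|k IH] f.
  by move=> fk x _; apply: (@continuous_comp _ _ _ f L); [exact: fk|exact: cL].
move=> [df Df].
have dfL x : differentiable (L \o f) x.
  by apply: differentiable_comp; [exact: df|exact: linear_differentiable].
split=> [x _|v]; first exact: dfL.
apply: eq_Ck (IH _ (Df v)) => x.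
rewrite !deriveE; [|exact: df|exact: dfL].
rewrite diff_comp /=; [|exact: df|exact: linear_differentiable].
by rewrite diff_lin.
Qed.

Lemma Ck_id V k : Ck k setT (fun x : V => x).
Proof.
case: k => [x _|k]; first exact: cvg_id.
split=> [x _|v]; first by have [] := is_diff_id x.
by apply: eq_Ck (@Ck_cst V V k v) => x; exact: derive_id.
Qed.

Lemma eq_smooth V W (f g : V -> W) : g =1 f -> smooth f -> smooth g.
Proof. by move=> /funext ->. Qed.

Lemma smooth_differentiable V W (f : V -> W) x : smooth f -> differentiable f x.
Proof. by move=> sf; apply: Ck_differentiable (sf 1%N). Qed.

Lemma smooth_derive V W (f : V -> W) v : smooth f -> smooth (fun x => 'D_v f x).
Proof. by move=> sf k; have [_ Df] := sf k.+1; exact: Df. Qed.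

Lemma smooth_cst V W (c : W) : smooth (fun _ : V => c).
Proof. by move=> k; exact: Ck_cst. Qed.

Lemma smoothD V W (f g : V -> W) : smooth f -> smooth g -> smooth (fun x => f x + g x).
Proof. by move=> sf sg k; exact: CkD. Qed.

Lemma smoothZl V W (f : V -> R) (w : W) : smooth f -> smooth (fun x => f x *: w).
Proof. by move=> sf k; exact: CkZl. Qed.

Lemma smoothM V (f g : V -> R) : smooth f -> smooth g -> smooth (fun x => f x * g x).
Proof. by move=> sf sg k; exact: CkM. Qed.

Lemma smoothN V (f : V -> R) : smooth f -> smooth (fun x => - f x).
Proof. by move=> sf k; exact: CkN. Qed.

Lemma smoothB V (f g : V -> R) : smooth f -> smooth g -> smooth (fun x => f x - g x).
Proof. by move=> sf sg; apply: smoothD => //; exact: smoothN. Qed.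

Lemma smoothX V (f : V -> R) n : smooth f -> smooth (fun x => f x ^+ n).
Proof.
move=> sf; elim: n => [|n IH]; first exact: smooth_cst.
by apply: eq_smooth (smoothM sf IH) => x; rewrite exprS.
Qed.

Lemma smoothV V (f : V -> R) : (forall x, f x != 0) -> smooth f ->
  smooth (fun x => (f x)^-1).
Proof. by move=> f0 sf k; exact: CkV. Qed.

Lemma smooth_sum V W (I : Type) (r : seq I) (P : pred I) (f : I -> V -> W) :
  (forall i, smooth (f i)) -> smooth (fun x => \sum_(i <- r | P i) f i x).
Proof.
move=> sf; elim: r => [|i r IH].
  by apply: eq_smooth (@smooth_cst V W 0) => x; rewrite big_nil.
apply: (@eq_smooth _ _ (fun x => (if P i then f i x else 0) + \sum_(i <- r | P i) f i x)) => [x|].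
  by rewrite big_cons; case: ifP => // _; rewrite add0r.
by apply: smoothD => //; case: (P i) => //; exact: smooth_cst.
Qed.

Lemma smooth_prod V (I : Type) (r : seq I) (P : pred I) (f : I -> V -> R) :
  (forall i, smooth (f i)) -> smooth (fun x => \prod_(i <- r | P i) f i x).
Proof.
move=> sf; elim: r => [|i r IH].
  by apply: (@eq_smooth V R (fun=> 1)) => [x|]; [rewrite big_nil|exact: smooth_cst].
apply: (@eq_smooth _ _ (fun x => (if P i then f i x else 1) * \prod_(i <- r | P i) f i x)) => [x|].
  by rewrite big_cons; case: ifP => // _; rewrite mul1r.
by apply: smoothM => //; case: (P i) => //; exact: smooth_cst.
Qed.

Lemma smooth_comp_linear V V' W (L : {linear V -> V'}) (f : V' -> W) : continuous L ->
  smooth f -> smooth (fun x => f (L x)).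
Proof. by move=> cL sf k; exact: Ck_comp. Qed.

Lemma smooth_linear_comp V W W' (L : {linear W -> W'}) (f : V -> W) : continuous L ->
  smooth f -> smooth (fun x => L (f x)).
Proof. by move=> cL sf k; exact: Ck_post. Qed.

Lemma smooth_entry V m n (f : V -> 'M[R]_(m, n)) i j :
  smooth f -> smooth (fun x => f x i j).
Proof.
have lin : linear (fun A : 'M[R]_(m, n) => A i j : R^o) by move=> a A B; rewrite !mxE.
pose L : {linear 'M[R]_(m, n) -> R} :=
  HB.pack (fun A : 'M[R]_(m, n) => A i j : R) (GRing.isLinear.Build _ _ _ _ _ lin).
move=> sf; apply: (@smooth_linear_comp _ _ _ L) => // A.
exact: coord_continuous.
Qed.

Lemma smooth_fst V1 V2 V (f : V -> V1 * V2) : smooth f -> smooth (fun x => (f x).1).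
Proof. by move=> sf; apply: (@smooth_linear_comp _ _ _ fst) => // z; exact: cvg_fst. Qed.

Lemma smooth_snd V1 V2 V (f : V -> V1 * V2) : smooth f -> smooth (fun x => (f x).2).
Proof. by move=> sf; apply: (@smooth_linear_comp _ _ _ snd) => // z; exact: cvg_snd. Qed.

Lemma smooth_mx V m n (f : V -> 'M[R]_(m, n)) :
  (forall i j, smooth (fun x => f x i j)) -> smooth f.
Proof.
move=> sf; apply: (@eq_smooth _ _ (fun x => \sum_i \sum_j f x i j *: delta_mx i j)) => [x|].
  exact: matrix_sum_delta.
by apply: smooth_sum => i; apply: smooth_sum => j; exact: smoothZl.
Qed.

Lemma smooth_det V n (f : V -> 'M[R]_n) :
  (forall i j, smooth (fun x => f x i j)) -> smooth (fun x => \det (f x)).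
Proof.
move=> sf; apply: smooth_sum => s; apply: smoothM; first exact: smooth_cst.
by apply: smooth_prod => i.
Qed.

Lemma smooth_invmx V n (f : V -> 'M[R]_n) i j : (forall x, f x \in unitmx) ->
  smooth f -> smooth (fun x => invmx (f x) i j).
Proof.
move=> uf sf.
apply: (@eq_smooth _ _ (fun x => (\det (f x))^-1 * (\adj (f x)) i j)) => [x|].
  by rewrite /invmx uf mxE.
have sfe i' j' : smooth (fun x => f x i' j') by exact: smooth_entry.
apply: smoothM.
  by apply: smoothV; [move=> x; have := uf x; rewrite unitmxE unitfE|exact: smooth_det].
apply: (@eq_smooth _ _ (fun x => (-1) ^+ (j + i) * \det (row' j (col' i (f x))))) => [x|].
  by rewrite mxE.
apply: smoothM; first exact: smooth_cst.
by apply: smooth_det => a b; apply: eq_smooth (sfe (lift j a) (lift i b)) => x; rewrite !mxE.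
Qed.

Lemma smooth_on_setT V W (f : V -> W) : smooth_on setT f -> smooth f.
Proof.
move=> [U [g [_ sU Cg fg]]].
have -> : f = g by apply/funext => x; exact: fg.
by rewrite (_ : U = setT) in Cg => //; apply/seteqP; split.
Qed.

Lemma smooth_smooth_on V W D (f : V -> W) : smooth f -> smooth_on D f.
Proof. by move=> sf; exists setT, f; split=> //; exact: openT. Qed.

End smooth.

(** * Differentiation along the real line *)

Section real_derivatives.
Context {R : realType}.

Lemma is_derive_le0 (f df : R -> R) (a b : R) : a <= b ->
  (forall t, a <= t <= b -> is_derive t 1 f (df t)) ->
  (forall t, a <= t <= b -> df t <= 0) -> f b <= f a.
Proof.
move=> ab fd df0.
apply: (@ler0_derive1_le_cc _ f a b) => //.
- by move=> x; rewrite in_itv/= => /andP[/ltW ax /ltW xb]; have [] := fd x; rewrite ?ax ?xb.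
- move=> x; rewrite in_itv/= => /andP[/ltW ax /ltW xb].
  by rewrite derive1E (@derive_val _ _ _ _ _ _ _ (fd x _)) ?df0 ?ax ?xb.
- apply: derivable_within_continuous => x; rewrite in_itv/= => /andP[ax xb].
  by have [] := fd x; rewrite ?ax ?xb.
- by rewrite in_itv/= lexx ab.
- by rewrite in_itv/= lexx ab.
Qed.

Lemma is_derive_ge0 (f df : R -> R) (a b : R) : a <= b ->
  (forall t, a <= t <= b -> is_derive t 1 f (df t)) ->
  (forall t, a <= t <= b -> 0 <= df t) -> f a <= f b.
Proof.
move=> ab fd df0; rewrite -lerN2.
apply: (@is_derive_le0 (\- f) (\- df)) => // t tab; last by rewrite /= oppr_le0 df0.
exact/is_deriveN/fd.
Qed.

Lemma is_derive_le (f g df dg : R -> R) (a b : R) : a <= b ->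
  (forall t, a <= t <= b -> is_derive t 1 f (df t)) ->
  (forall t, a <= t <= b -> is_derive t 1 g (dg t)) ->
  (forall t, a <= t <= b -> df t <= dg t) -> f b - f a <= g b - g a.
Proof.
move=> ab fd gd dfg; have : f b - g b <= f a - g a.
  apply: (@is_derive_le0 (f \- g) (df \- dg)) => // t tab; last by rewrite /= subr_le0 dfg.
  by apply: is_deriveB; [exact: fd|exact: gd].
by lra.
Qed.

Lemma is_derive_continuous (W : normedModType R) (f : R -> W) (t : R) l :
  is_derive t 1 f l -> {for t, continuous f}.
Proof. by case=> /derivable1_diffP df _; exact: differentiable_continuous. Qed.

Lemma is_deriveP (W : normedModType R) (f : R -> W) (t : R) l :
  is_derive t 1 f l <-> (h^-1 *: (f (h + t) - f t) @[h --> 0^'] --> l).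
Proof.
have E : (fun h => h^-1 *: (f (h *: 1 + t) - f t)) = (fun h => h^-1 *: (f (h + t) - f t)).
  by apply/funext => h; rewrite [_ *: 1]mulr1.
split=> [[/cvg_ex[/= k]]|H].
  by rewrite /derive E => kl <-; rewrite (cvg_lim _ kl).
have {}E : h^-1 *: ((f \o shift t) (h *: 1) - f t) @[h --> 0^'] --> l by rewrite E.
by apply: DeriveDef; [apply/cvg_ex; exists l|exact: cvg_lim].
Qed.

Lemma near_dnbhs_right_left (P : set R) (a : R) :
  (\forall h \near a^'+, P h) -> (\forall h \near a^'-, P h) -> \forall h \near a^', P h.
Proof.
move=> r l; apply: (@filterS2 _ (nbhs a) _ _ _ _ _ r l) => h hr hl ha.
by case: (ltgtP h a) ha => [/hl+ _|/hr+ _|-> /eqP].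
Qed.

Lemma is_derive_solves (W : normedModType R) (x f : R -> W) :
  (forall t : R, 0 <= t -> is_derive t 1 x (f t)) -> solves x f.
Proof.
move=> H; split=> [|t /ltW]; last exact: H.
have /is_deriveP/cvg_dnbhs_at_right := H 0 (lexx _).
by under eq_fun do rewrite addr0.
Qed.

(* The linear extension to negative times turns the one-sided derivative at 0
   into a two-sided one. *)
Lemma solves_is_derive (W : normedModType R) (x f : R -> W) : solves x f ->
  exists y : R -> W, [/\ continuous y, forall t : R, 0 <= t -> y t = x t &
    forall t : R, 0 <= t -> is_derive t 1 y (f t)].
Proof.
move=> [x0 xt]; pose z t : W := x 0 + t *: f 0.
pose y t := if 0 <= t then x t else z t.
have z' (t : R) : is_derive t 1 z (f 0).
  apply/is_deriveP; apply: (@cvg_trans _ (f 0 @[h --> (0:R)^'])); last exact: cvg_cst.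
  apply: near_eq_cvg; near=> h.
  rewrite /z opprD addrACA subrr add0r -scalerBl addrK scalerA mulVf ?scale1r//.
  by near: h; exact: nbhs_dnbhs_neq.
have y' (t : R) : is_derive t 1 y (f (Num.max 0 t)).
  case: (ltgtP t 0) => [t0|t0|->].
  - apply: near_eq_is_derive (z' t); near=> s.
    by rewrite /y leNgt ifF//; apply/negbTE; rewrite negbK; near: s; exact: lt_nbhsl.
  - apply: near_eq_is_derive (xt t t0); near=> s.
    by rewrite /y ifT//; apply: ltW; near: s; exact: lt_nbhsr.
  - apply/is_deriveP; rewrite /y lexx => U Ul; apply: near_dnbhs_right_left; [move: U Ul|move: U Ul].
      apply: cvg_trans x0; apply: near_eq_cvg; near=> h.
      by rewrite addr0 ifT//; apply: ltW; near: h; exact: nbhs_right_gt.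
    have /is_deriveP/cvg_dnbhs_at_left := z' 0.
    apply: cvg_trans; apply: near_eq_cvg; near=> h.
    rewrite !addr0 leNgt ifF /z ?scale0r ?addr0//; apply/negbTE; rewrite negbK.
    by near: h; exact: nbhs_left_lt.
exists y; split=> [t|t t0|t t0].
- exact: is_derive_continuous (y' t).
- by rewrite /y t0.
- by have := y' t; rewrite (max_idPr _).
Unshelve. all: by end_near. Qed.

(** Integrating from [-1] makes 0 an interior point, so the primitive has a two-sided derivative
    there. *)
Lemma continuous_primitive (g : R -> R) : continuous g ->
  exists G : R -> R, G 0 = 0 /\ forall t : R, -1 < t -> is_derive t 1 G (g t).
Proof.
move=> cg; pose F x := (\int[lebesgue_measure]_(t in `[-1, x]) g t)%R.
have F' (t : R) : -1 < t -> is_derive t 1 F (g t).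
  move=> t1; have t1' : t < t + 1 by rewrite ltrDl.
  have [] := @continuous_FTC1_closed R g (-1) t (t + 1) t1' _ t1 (cg t).
    apply: continuous_compact_integrable; first exact: segment_compact.
    exact: continuous_subspaceT.
  by move=> dF; rewrite derive1E => <-; exact: derivableP.
exists (fun t => F t - F 0); split=> [|t /F' Ft]; first by rewrite subrr.
by apply: is_derive_eq; rewrite subr0.
Qed.

Section pointwise_rules.
Variable t : R.
Implicit Types f g : R -> R.

Lemma is_derive_fcst c : is_derive t 1 (fun=> c : R) 0.
Proof. exact: is_derive_cst. Qed.

Lemma is_derive_fadd f g df dg : is_derive t 1 f df -> is_derive t 1 g dg ->
  is_derive t 1 (fun s => f s + g s) (df + dg).
Proof. by move=> f' g'; exact: is_deriveD. Qed.

Lemma is_derive_fsub f g df dg : is_derive t 1 f df -> is_derive t 1 g dg ->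
  is_derive t 1 (fun s => f s - g s) (df - dg).
Proof. by move=> f' g'; exact: is_deriveB. Qed.

Lemma is_derive_fmul f g df dg : is_derive t 1 f df -> is_derive t 1 g dg ->
  is_derive t 1 (fun s => f s * g s) (df * g t + f t * dg).
Proof.
move=> f' g'; have := is_deriveM f' g'.
by rewrite /GRing.scale /= addrC [g t * _]mulrC.
Qed.

Lemma is_derive_fmull c f df : is_derive t 1 f df -> is_derive t 1 (fun s => c * f s) (c * df).
Proof.
move=> f'; have := is_derive_fmul (is_derive_fcst c) f'.
by rewrite mul0r add0r.
Qed.

Lemma is_derive_fsqr f df : is_derive t 1 f df ->
  is_derive t 1 (fun s => f s ^+ 2) (2 * f t * df).
Proof.
move=> f'; have -> : 2 * f t * df = df * f t + f t * df by ring.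
exact: (is_derive_fmul f' f').
Qed.

Lemma is_derive_finv f df : f t != 0 -> is_derive t 1 f df ->
  is_derive t 1 (fun s => (f s)^-1) (- df / f t ^+ 2).
Proof.
move=> f0 [f' <-]; apply: DeriveDef; first exact: derivableV.
by rewrite deriveV// exprnN /GRing.scale /= mulNr mulrC mulNr.
Qed.

Lemma is_derive_fexp f df : is_derive t 1 f df ->
  is_derive t 1 (fun s => expR (f s)) (df * expR (f t)).
Proof. by move=> f'; rewrite mulrC; apply: (@is_derive1_comp _ expR). Qed.

Lemma is_derive_expRN : is_derive t 1 (fun s => expR (- s)) (- 1 * expR (- t)).
Proof. exact: is_derive_fexp. Qed.

Lemma is_derive_fsum (I : finType) (h dh : I -> R -> R) :
  (forall i, is_derive t 1 (h i) (dh i t)) ->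
  is_derive t 1 (fun s => \sum_i h i s) (\sum_i dh i t).
Proof.
move=> h'; elim: (index_enum I) => [|i r IH].
  rewrite big_nil (_ : (fun s => _) = fun=> 0); first exact: is_derive_fcst.
  by apply/funext => s; rewrite big_nil.
rewrite big_cons (_ : (fun s => _) = (fun s => h i s + \sum_(i <- r) h i s)).
  exact: is_derive_fadd.
by apply/funext => s; rewrite big_cons.
Qed.

End pointwise_rules.

End real_derivatives.

(** * The Picard-Lindelof theorem *)

Section picard.
Context {R : realType} {I : finType}.
Implicit Types (t T K c : R) (y z : I -> R).

Lemma le0_geometric (a b : R) : (forall n, a <= b * 2^-1 ^+ n) -> a <= 0.
Proof.
move=> ab.
have : b * 2^-1 ^+ n @[n --> \oo] --> b * (0 : R).
  by apply: cvgMr; apply: cvg_expr; rewrite ger0_norm ?invr_ge0// invf_lt1 ?ltr1n.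
rewrite mulr0 => bc; by apply: (cvgr_to_ge bc); apply: nearW => n; exact: ab.
Qed.

(** Integration gains a factor [1 / lam] in the norm weighted by [expR (- lam * t)]; this is what
    makes the Picard map a contraction on [[0, T]] whatever [T] is. *)
Lemma le_expR_growth (f df : R -> R) c lam T : 0 <= c ->
  f 0 = 0 -> (forall t, 0 <= t <= T -> is_derive t 1 f (df t)) ->
  (forall t, 0 <= t <= T -> `|df t| <= c * (lam * expR (lam * t))) ->
  forall t, 0 <= t <= T -> `|f t| <= c * expR (lam * t).
Proof.
move=> c0 f0 f' dfc t /andP[t0 tT].
have e' (s : R) : is_derive s 1 (fun s => c * expR (lam * s)) (c * (lam * expR (lam * s))).
  apply/is_derive_fmull/is_derive_fexp.
  by have := is_derive_fmull lam (@is_derive_id R R s 1); rewrite mulr1.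
have sub s : 0 <= s <= t -> 0 <= s <= T by move=> /andP[-> /le_trans]; apply.
have ec : 0 <= c * expR (lam * 0) by rewrite mulr_ge0// expR_ge0.
rewrite ler_norml; apply/andP; split.
  have : - f t - - f 0 <= c * expR (lam * t) - c * expR (lam * 0).
    apply: (@is_derive_le _ (\- f) _ (\- df)) => // s /sub sT; first exact/is_deriveN/f'.
    by have := dfc s sT; rewrite ler_norml => /andP[+ _]; rewrite /=; lra.
  by rewrite f0; lra.
have : f t - f 0 <= c * expR (lam * t) - c * expR (lam * 0).
  apply: (@is_derive_le _ f _ df) => // s /sub sT; first exact: f'.
  by have := dfc s sT; rewrite ler_norml => /andP[].
by rewrite f0; lra.
Qed.

Variables (F : I -> R -> (I -> R) -> R) (y0 : I -> R).
Hypothesis cF : forall y : I -> R -> R, (forall i, continuous (y i)) ->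
  forall i, continuous (fun t => F i t (y ^~ t)).
Hypothesis LF : forall T, 0 <= T -> exists2 K : R, 0 < K &
  forall t y z c, 0 <= t <= T -> (forall j, `|y j - z j| <= c) ->
  forall i, `|F i t y - F i t z| <= K * c.

Let pos t := Num.max 0 t.

Let prim (g : R -> R) : R -> R :=
  get [set G | G 0 = 0 /\ forall t, -1 < t -> is_derive t 1 G (g t)].

Let primP g : continuous g ->
  prim g 0 = 0 /\ forall t, -1 < t -> is_derive t 1 (prim g) (g t).
Proof. by move=> /continuous_primitive[G HG]; rewrite /prim; case: xgetP => [_ _ //|/(_ G)]. Qed.

(** Composing with [pos] freezes the iterates at negative times, where the primitive is controlled
    only down to [-1]; they become continuous on the whole line, as [cF] requires. *)
Fixpoint picard_iter n (i : I) (t : R) : R :=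
  if n is n'.+1 then y0 i + prim (fun s => F i s (picard_iter n' ^~ s)) (pos t)
  else y0 i.
Local Notation Y := picard_iter.

Let pos_ge0 t : 0 <= pos t. Proof. by rewrite le_max lexx. Qed.
Let pos_id t : 0 <= t -> pos t = t. Proof. by move=> t0; rewrite /pos (max_idPr _). Qed.
Let continuous_pos : continuous pos.
Proof. by move=> t; apply: continuous_max; [exact: cst_continuous|exact: cvg_id]. Qed.

Let Y_continuous n i : continuous (Y n i).
Proof.
elim: n i => [|n IH] i t; first exact: cst_continuous.
apply: cvgD; first exact: cst_continuous.
apply: (@continuous_comp _ _ _ pos (prim (fun s => F i s (Y n ^~ s)))); first exact: continuous_pos.
have [_ /(_ (pos t))] := primP (cF IH (i := i)).
by move=> H; apply: is_derive_continuous (H _); rewrite (lt_le_trans (ltrN10 _)).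
Qed.

Let Y_pos n i t : Y n i t = Y n i (pos t).
Proof. by case: n => //= n; rewrite [pos (pos t)]pos_id. Qed.

Let Y_derive n i t : 0 <= t ->
  is_derive t 1 (fun s => y0 i + prim (fun s => F i s (Y n ^~ s)) s) (F i t (Y n ^~ t)).
Proof.
move=> t0; have [_ /(_ t)] := primP (@cF _ (@Y_continuous n) i).
rewrite (lt_le_trans (ltrN10 _))// => /(_ isT) d.
by have := is_derive_fadd (is_derive_fcst t (y0 i)) d; rewrite add0r.
Qed.

Let YS n i t : 0 <= t -> Y n.+1 i t = y0 i + prim (fun s => F i s (Y n ^~ s)) t.
Proof. by move=> t0 /=; rewrite pos_id. Qed.

Let prim0 n i : prim (fun s => F i s (Y n ^~ s)) 0 = 0.
Proof. by have [] := primP (@cF _ (@Y_continuous n) i). Qed.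

(* The weight [expR (lam * t)] with [lam = 2 * K] halves the distance of
   successive iterates on the whole interval [0, T]. *)
Let Y_diff T : 0 <= T -> exists C lam : R, [/\ 0 <= C, 0 < lam &
  forall n i t, 0 <= t <= T -> `|Y n.+1 i t - Y n i t| <= C * 2^-1 ^+ n * expR (lam * t)].
Proof.
move=> T0; have [K K0 HK] := LF T0.
have [C0 C0ge HC] : exists2 C, 0 <= C & forall i t, 0 <= t <= T -> `|F i t y0| <= C.
  have H i : exists C, forall t, 0 <= t <= T -> `|F i t y0| <= C.
    have cFi : {within `[0, T], continuous (fun t => `|F i t y0|)}.
      apply: continuous_subspaceT => t; apply: cvg_norm.
      by have := (@cF (fun i _ => y0 i)); apply => j s; exact: cst_continuous.
    have [c _ Hc] := EVT_max T0 cFi.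
    by exists (`|F i c y0|) => t tT; apply: Hc; rewrite in_itv.
  have [C HC] := choice H.
  exists (\sum_i `|C i|); first by apply: sumr_ge0 => i _; exact: normr_ge0.
  move=> i t tT; rewrite (le_trans (HC i t tT))// (le_trans (ler_norm _))//.
  by rewrite (bigD1 i)//= lerDl sumr_ge0.
(* The first constant is fixed by the base case: its product with [lam = 2 * K] is the bound [C0] on
   the field at [y0]. *)
exists (C0 / (2 * K)), (2 * K); split; [by rewrite divr_ge0// mulr_ge0// ltW|by rewrite mulr_gt0|].
have K2 : 0 < 2 * K by rewrite mulr_gt0.
have e1 t : 0 <= t -> 1 <= expR (2 * K * t).
  by move=> t0; rewrite -[leLHS]expR0 ler_expR mulr_ge0// ltW.
elim=> [|n IH] i t tT.
  have t0 : 0 <= t by case/andP: tT.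
  rewrite YS// /= addrC addKr expr0 mulr1.
  apply: (@le_expR_growth _ (fun s => F i s (Y 0 ^~ s)) _ _ T) => //.
  - by rewrite divr_ge0// ltW.
  - exact: (prim0 0 i).
  - move=> s /andP[s0 sT]; have [_] := primP (@cF _ (@Y_continuous 0) i); apply.
    by rewrite (lt_le_trans (ltrN10 _)).
  - move=> s sT; rewrite mulrA divfK ?gt_eqF//.
    have /andP[/e1 s1 _] := sT.
    by rewrite (le_trans (HC i s sT))// ler_peMr.
have t0 : 0 <= t by case/andP: tT.
rewrite YS// [Y n.+1 i t]YS//.
pose f s := (y0 i + prim (fun s => F i s (Y n.+1 ^~ s)) s) - (y0 i + prim (fun s => F i s (Y n ^~ s)) s).
apply: (@le_expR_growth f (fun s => F i s (Y n.+1 ^~ s) - F i s (Y n ^~ s)) _ _ T) => //.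
- by rewrite !mulr_ge0 ?exprn_ge0 ?invr_ge0// ltW.
- by rewrite /f !prim0 subrr.
- by move=> s /andP[s0 _]; apply: is_deriveB; exact: Y_derive.
- move=> s sT; apply: le_trans (HK _ _ _ _ sT (fun j => IH j s sT) i) _.
  rewrite exprS le_eqVlt; apply/orP; left; apply/eqP; field.
  by rewrite gt_eqF.
Qed.

Let Y_lim : exists y : I -> R -> R, forall T, 0 <= T ->
  exists2 B : R, 0 <= B & forall n i t, t <= T -> `|Y n i t - y i t| <= B * 2^-1 ^+ n.
Proof.
have HB T : 0 <= T -> exists2 B : R, 0 <= B &
    forall n m i t, (n <= m)%N -> t <= T -> `|Y n i t - Y m i t| <= B * 2^-1 ^+ n.
  move=> T0; have [C [lam [C0 l0 HC]]] := Y_diff T0.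
  exists (2 * (C * expR (lam * T))); first by rewrite !mulr_ge0// expR_ge0.
  move=> n m i t nm tT; rewrite Y_pos [Y m i t]Y_pos.
  have pT : 0 <= pos t <= T by rewrite pos_ge0 ge_max T0 tT.
  (* Telescoping: the powers of [2^-1] with exponents from [n] to [n + k - 1] add up to twice the
     difference on the right. *)
  suff H k : `|Y n i (pos t) - Y (n + k) i (pos t)| <=
      2 * (C * expR (lam * T)) * (2^-1 ^+ n - 2^-1 ^+ (n + k)).
    have := H (m - n)%N; rewrite subnKC// => /le_trans; apply.
    by rewrite ler_wpM2l// ?lerBlDr ?lerDl ?exprn_ge0 ?invr_ge0// !mulr_ge0 ?expR_ge0.
  elim: k => [|k IH]; first by rewrite addn0 !subrr normr0 mulr0.
  rewrite addnS -(subrKA (Y (n + k)%N i (pos t))) (le_trans (ler_normD _ _))//.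
  have D := HC (n + k)%N i _ pT; rewrite distrC in D.
  have E : expR (lam * pos t) <= expR (lam * T).
    by case/andP: pT => _ pT; rewrite ler_expR ler_wpM2l// ltW.
  have Cg : 0 <= C * 2^-1 ^+ (n + k) by rewrite mulr_ge0 ?exprn_ge0 ?invr_ge0.
  have {}D := le_trans D (ler_wpM2l Cg E).
  rewrite exprS.
  by rewrite (le_trans (lerD IH D))// le_eqVlt; apply/orP; left; apply/eqP; field.
have cvgY i t : cvg (Y n i t @[n --> \oo]).
  have [B B0 {}HB] := HB (`|t|) (normr_ge0 _).
  apply/cauchy_cvgP/cauchy_exP => e e0.
  have [N HN] : exists N, B * 2^-1 ^+ N < e.
    apply: contrapT => /forallNP H; suff : e <= 0 by rewrite leNgt e0.
    by apply: (@le0_geometric _ B) => n; rewrite leNgt; apply/negP/H.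
  exists (Y N i t); suff : \forall m \near \oo, ball (Y N i t) e (Y m i t) by [].
  near=> m; rewrite -ball_normE /=; apply: le_lt_trans HN; apply: HB; last exact: ler_norm.
  by near: m; exact: nbhs_infty_ge.
exists (fun i t => lim (Y n i t @[n --> \oo])) => T T0.
have [B B0 {}HB] := HB T T0; exists B => // n i t tT.
have := cvgY i t => /(cvgB (cvg_cst (Y n i t)))/cvg_norm /cvgr_to_le; apply.
by near=> m; apply: HB => //; near: m; exact: nbhs_infty_ge.
Unshelve. all: by end_near. Qed.

Theorem picard_lindelof : exists y : I -> R -> R,
  (forall i, y i 0 = y0 i) /\
  (forall t, 0 <= t -> forall i, is_derive t 1 (y i) (F i t (y ^~ t))).
Proof.
have [y Hy] := Y_lim.
have yc i : continuous (y i).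
  move=> t; apply/cvgrPdist_le => e e0.
  have [|B B0 HB] := Hy (`|t| + 1); first by rewrite addr_ge0.
  have [N HN] : exists N, B * 2^-1 ^+ N <= e / 3.
    apply: contrapT => /forallNP H; suff : e / 3 <= 0 by rewrite leNgt divr_gt0.
    apply: (@le0_geometric _ B) => n; rewrite leNgt; apply/negP => /ltW; exact: H.
  have e3 : 0 < e / 3 by rewrite divr_gt0.
  have /cvgrPdist_le/(_ _ e3) cY := @Y_continuous N i t.
  near=> s.
  have st : s <= `|t| + 1.
    apply: ltW; near: s; apply: lt_nbhsl; rewrite (le_lt_trans (ler_norm t))// ltrDl//.
  have t1 : t <= `|t| + 1 by rewrite (le_trans (ler_norm t))// lerDl.
  have a1 := le_trans (HB N i s st) HN; have a2 := le_trans (HB N i t t1) HN.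
  have a3 : `|Y N i t - Y N i s| <= e / 3 by near: s.
  move: a1 a2 a3; rewrite !ler_norml => /andP[? ?] /andP[? ?] /andP[? ?].
  by apply/andP; split; lra.
(* The limit [y] is constant at negative times and may fail to be differentiable at 0. The solution
   returned is the primitive [z], which agrees with [y] for [t >= 0]. *)
pose z i t := y0 i + prim (fun s => F i s (y ^~ s)) t.
have zd t i : 0 <= t -> is_derive t 1 (z i) (F i t (y ^~ t)).
  move=> t0; have [_ /(_ t)] := primP (@cF _ yc i).
  rewrite (lt_le_trans (ltrN10 _))// => /(_ isT) d.
  by have := is_derive_fadd (is_derive_fcst t (y0 i)) d; rewrite add0r.
have z0 i : z i 0 = y0 i by rewrite /z; have [-> _] := primP (@cF _ yc i); rewrite addr0.
suff zy i t : 0 <= t -> z i t = y i t.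
  exists z; split=> // t t0 i; have := zd t i t0.
  by rewrite (_ : z ^~ t = y ^~ t)//; apply/funext => j; exact: zy.
(* Both [z] and [y] lie within a multiple of [2^-1 ^+ n] of the iterate [n.+1]: [y] by the rate of
   convergence, [z] by integrating the Lipschitz bound over [[0, t]]. *)
move=> t0; have [B B0 HB] := Hy _ t0; have [K K0 HK] := LF t0.
apply/eqP; rewrite -subr_eq0 -normr_le0; apply: (@le0_geometric _ (B * K * t + B)) => n.
have H1 := HB n.+1 i t (lexx _).
suff H2 : `|z i t - Y n.+1 i t| <= B * K * t * 2^-1 ^+ n.
  rewrite -(subrKA (Y n.+1 i t)) (le_trans (ler_normD _ _))// mulrDl lerD// (le_trans H1)//.
  by rewrite ler_wpM2l// exprS ler_piMl ?exprn_ge0 ?invr_ge0// invf_le1 ?ler1n.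
have D s : 0 <= s <= t -> `|F i s (y ^~ s) - F i s (Y n ^~ s)| <= B * K * 2^-1 ^+ n.
  move=> st; have := HK s _ _ (B * 2^-1 ^+ n) st _ i.
  rewrite [B * K]mulrC -mulrA; apply => j; rewrite distrC; apply: HB.
  by case/andP: st.
have lin (c s : R) : is_derive s 1 (fun s => c * s) c.
  by have := is_derive_fmull c (@is_derive_id R R s 1); rewrite mulr1.
rewrite YS// ler_norml.
pose w s := y0 i + prim (fun s => F i s (Y n ^~ s)) s.
have w0 : w 0 = y0 i by rewrite /w prim0 addr0.
have d' s : 0 <= s <= t ->
    is_derive s 1 (fun s => z i s - w s) (F i s (y ^~ s) - F i s (Y n ^~ s)).
  by move=> /andP[s0 _]; apply: is_derive_fsub; [exact: zd|exact: Y_derive].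
have U := @is_derive_le _ _ _ _ _ _ _ t0 d' (fun s _ => lin (B * K * 2^-1 ^+ n) s) _.
have L := @is_derive_le _ _ _ _ _ _ _ t0 (fun s _ => lin (- (B * K * 2^-1 ^+ n)) s) d' _.
rewrite -/(w t).
have {}U := U (fun s st => le_trans (ler_norm _) (D s st)).
have {}L := L (fun s st => proj1 (andP (eq_ind _ is_true (D s st) _ (ler_norml _ _)))).
move: U L; rewrite z0 w0 !mulr0 => U L; apply/andP; split; lra.
Unshelve. all: by end_near. Qed.

End picard.

(** * Global solutions from a priori bounds *)

Section global_ode.
Context {R : realType} {I : finType}.
Implicit Types (t T K c : R) (y z : I -> R).

Lemma continuous_bounded (f : R -> R) T : continuous f ->
  exists2 C : R, 0 <= C & forall t, 0 <= t <= T -> `|f t| <= C.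
Proof.
move=> cf; have [T0|T0] := leP 0 T; last first.
  by exists 0 => // t /andP[t0 /(le_trans t0)]; rewrite leNgt T0.
have cF : {within `[0, T], continuous (fun t => `|f t|)}.
  by apply: continuous_subspaceT => t; apply: cvg_norm; exact: cf.
have [c _ Hc] := EVT_max T0 cF.
by exists (`|f c|) => // t tT; apply: Hc; rewrite in_itv.
Qed.

Definition clip c x : R := Num.max (- c) (Num.min c x).

Lemma clip_id c x : `|x| <= c -> clip c x = x.
Proof. by rewrite ler_norml => /andP[a b]; rewrite /clip (min_idPr _)// (max_idPr _). Qed.

Lemma clip_le c x : 0 <= c -> `|clip c x| <= c.
Proof.
move=> c0; rewrite ler_norml le_max lexx ge_max ge_min lexx/= andbT.
by rewrite (le_trans _ c0)// oppr_le0.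
Qed.

Lemma clip_lipschitz c (x x' : R) : `|clip c x - clip c x'| <= `|x - x'|.
Proof.
have := ler_norm (x' - x); have := ler_norm (x - x'); rewrite [`|x' - x|]distrC.
move: `|x - x'| => N; rewrite /clip /Order.max /Order.min ler_norml.
by case: (ltP c x) => ?; case: (ltP c x') => ?; do 2?case: ltP => ?; move=> *; apply/andP; split; lra.
Qed.

Variables (F : I -> R -> (I -> R) -> R) (y0 : I -> R) (b : R -> R).
Hypothesis cF : forall y : I -> R -> R, (forall i, continuous (y i)) ->
  forall i, continuous (fun t => F i t (y ^~ t)).
Hypothesis LF : forall T rho, exists2 K : R, 0 < K &
  forall t y z c, 0 <= t <= T -> (forall j, `|y j| <= rho) -> (forall j, `|z j| <= rho) ->
  (forall j, `|y j - z j| <= c) -> forall i, `|F i t y - F i t z| <= K * c.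
Hypothesis cb : continuous b.
Hypothesis b0 : forall i, `|y0 i| <= b 0.
Hypothesis apriori : forall T (y : I -> R -> R), 0 < T -> (forall i, y i 0 = y0 i) ->
  (forall t, 0 <= t < T -> forall i, is_derive t 1 (y i) (F i t (y ^~ t))) ->
  forall t, 0 <= t < T -> forall i, `|y i t| <= b t.

(** Clipping the state at radius [B t] makes the field Lipschitz on bounded time intervals, so the
    clipped equation has a global solution, and [apriori] shows that the clipping never acts. It is
    assumed on half-open intervals so that it applies up to the first exit time. *)
Theorem ode_global : exists y : I -> R -> R, (forall i, y i 0 = y0 i) /\
  (forall t, 0 <= t -> forall i, is_derive t 1 (y i) (F i t (y ^~ t))).
Proof.
(* The margin 1 puts the a priori bound strictly inside the clipping radius. *)
pose B t := `|b t| + 1.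
have B0 t : 0 <= B t by rewrite addr_ge0.
have cB : continuous B by move=> t; apply: cvgD; [apply: cvg_norm; exact: cb|exact: cst_continuous].
pose G i t y := F i t (fun j => clip (B t) (y j)).
have [y [y0E y']] : exists y : I -> R -> R, (forall i, y i 0 = y0 i) /\
    (forall t, 0 <= t -> forall i, is_derive t 1 (y i) (G i t (y ^~ t))).
  apply: picard_lindelof => [y cy i|T T0].
    apply: cF => j t; apply: (@continuous_max _ _ (fun t => - B t)) => /=.
      by apply: cvgN; exact: cB.
    by apply: (@continuous_min _ _ B); [exact: cB|exact: cy].
  have [rho _ Hrho] := continuous_bounded T cB.
  have [K K0 HK] := LF T rho; exists K => // t y z c tT yz i.
  have cl x : `|clip (B t) x| <= rho.
    by rewrite (le_trans (clip_le _ _))// (le_trans (ler_norm _))// Hrho.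
  by apply: HK => // j; rewrite (le_trans (clip_lipschitz _ _ _)).
have yc t i : 0 <= t -> {for t, continuous (y i)}.
  by move=> t0; exact: is_derive_continuous (y' t t0 i).
pose S := [set t | 0 <= t /\ exists i, B t <= `|y i t|].
have [S0|/set0P/negP/negPn/eqP S0] := pselect (S !=set0); last first.
  exists y; split=> // t t0 i; have := y' t t0 i; rewrite /G.
  suff -> : (fun j => clip (B t) (y j t)) = y ^~ t by [].
  apply/funext => j; apply: clip_id; rewrite leNgt; apply/negP => /ltW H.
  by have : S t by [split=> //; exists j]; rewrite S0.
exfalso.
have lS : has_inf S by split=> //; exists 0 => t [].
pose T := inf S.
have T0 : 0 <= T by apply: lb_le_inf => // t [].
have ok t : 0 <= t < T -> forall i, `|y i t| < B t.
  move=> /andP[t0 tT] i; rewrite ltNge; apply/negP => H.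
  have : T <= t by apply: ge_inf; [exact: lS.2|split=> //; exists i].
  by rewrite leNgt tT.
have okT i : `|y i T| <= b T.
  case: (ltgtP T 0) => [|T1|->]; [by rewrite ltNge T0| |by rewrite y0E].
  have H t : 0 <= t < T -> `|y i t| <= b t.
    move=> tT; apply: (apriori T1 y0E) => // s sT j.
    have := y' s (andP sT).1 j; rewrite /G.
    suff -> : (fun j => clip (B s) (y j s)) = y ^~ s by [].
    by apply/funext => k; apply: clip_id; exact/ltW/ok.
  have c1 : `|y i t| @[t --> T^'-] --> `|y i T|.
    by apply: cvg_at_left_filter; apply: cvg_norm; exact: yc.
  have c2 : b t @[t --> T^'-] --> b T by apply: cvg_at_left_filter; exact: cb.
  apply: (ler_cvg_to c1 c2); near=> t; apply: H; apply/andP; split.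
    by apply: ltW; near: t; exact: nbhs_left_gt.
  by near: t; exact: nbhs_left_lt.
(* At the exit time [T] the state is bounded by [b T < B T]. The strict inequality persists shortly
   after [T], so no exit occurs there, although [T] is the infimum of the exit times. *)
have : \forall s \near T, forall i, `|y i s| < B s.
  apply: (@filter_forall R I (fun i s => `|y i s| < B s) (nbhs T) (nbhs_filter T)) => i.
  have c1 : B s - `|y i s| @[s --> T] --> B T - `|y i T|.
    by apply: cvgB; [exact: cB|apply: cvg_norm; exact: yc].
  have : 0 < B T - `|y i T|.
    by rewrite subr_gt0 /B ltr_pwDr// (le_trans (okT i))// ler_norm.
  by move=> /(cvgr_gt _ c1); apply: filterS => s; rewrite subr_gt0.
move=> /nbhs_ballP[e /= e0 He].
have [s [s0 [i Hi]] sT] := @inf_adherent _ S e e0 lS.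
have := He s; rewrite /ball /=.
have Ts : T <= s by apply: ge_inf; [exact: lS.2|split=> //; exists i].
rewrite ltr_norml => /(_ _ i) H.
suff : `|y i s| < B s by rewrite ltNge Hi.
by apply: H; apply/andP; split; rewrite /T in Ts *; lra.
Unshelve. all: by end_near. Qed.

End global_ode.

(** * Locally Lipschitz right-hand sides *)

Section locally_lipschitz.
Context {R : realType} {I : finType}.
Implicit Types (f g : R -> (I -> R) -> R).

(* Continuity along continuous curves stands in for joint continuity: it is all
   that Picard iteration uses. *)
Definition loclip f :=
  (forall y : I -> R -> R, (forall i, continuous (y i)) ->
     continuous (fun t => f t (y ^~ t))) /\
  (forall T rho : R, exists2 K : R, 0 <= K &
     forall t (y z : I -> R) c, 0 <= t <= T ->
       (forall j, `|y j| <= rho) -> (forall j, `|z j| <= rho) -> 0 <= c ->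
       (forall j, `|y j - z j| <= c) -> `|f t y - f t z| <= K * c).

Lemma loclip_time (g : R -> R) : continuous g -> loclip (fun t _ => g t).
Proof.
move=> cg; split=> // T rho; exists 0 => // t y z c _ _ _ _ _.
by rewrite subrr normr0 mul0r.
Qed.

Lemma loclip_coord i : loclip (fun _ y => y i).
Proof.
split=> [y cy|T rho]; first exact: cy.
by exists 1 => // t y z c _ _ _ _ yz; rewrite mul1r.
Qed.

Lemma loclipD f g : loclip f -> loclip g ->
  loclip (fun t y => f t y + g t y).
Proof.
move=> [cf Lf] [cg Lg]; split=> [y cy t|T rho].
  by apply: cvgD; [exact: cf|exact: cg].
have [K K0 HK] := Lf T rho; have [L L0 HL] := Lg T rho.
exists (K + L) => [|t y z c tT yr zr c0 yz]; first exact: addr_ge0.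
rewrite opprD addrACA mulrDl (le_trans (ler_normD _ _))// lerD//.
  exact: HK yz.
exact: HL yz.
Qed.

Lemma loclip_bounded f (T rho : R) : loclip f -> exists2 C : R, 0 <= C &
  forall t (y : I -> R), 0 <= t <= T -> (forall j, `|y j| <= rho) -> `|f t y| <= C.
Proof.
(* The comparison point is the zero state, which lies in the ball of radius [|rho|] even when [rho]
   is negative. *)
move=> [cf Lf]; have [K K0 HK] := Lf T `|rho|.
have [|C C0 HC] := @continuous_bounded R (fun t => f t (fun=> 0)) T.
  by have := (cf (fun _ _ => 0)); apply => i t; exact: cst_continuous.
exists (C + K * `|rho|) => [|t y tT yr]; first by rewrite addr_ge0// mulr_ge0.
rewrite -(subrK (f t (fun=> 0)) (f t y)) addrC (le_trans (ler_normD _ _))// lerD//.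
  exact: HC.
apply: HK => // j; first by rewrite (le_trans (yr j))// ler_norm.
  by rewrite normr0.
by rewrite subr0 (le_trans (yr j))// ler_norm.
Qed.

Lemma loclipM f g : loclip f -> loclip g ->
  loclip (fun t y => f t y * g t y).
Proof.
move=> rf rg; have [[cf Lf] [cg Lg]] := (rf, rg); split=> [y cy t|T rho].
  by apply: cvgM; [exact: cf|exact: cg].
have [K K0 HK] := Lf T rho; have [L L0 HL] := Lg T rho.
have [C C0 HC] := loclip_bounded T rho rf.
have [D D0 HD] := loclip_bounded T rho rg.
exists (K * D + C * L) => [|t y z c tT yr zr c0 yz]; first by rewrite addr_ge0// mulr_ge0.
rewrite (_ : _ - _ = (f t y - f t z) * g t y + f t z * (g t y - g t z)); last by ring.
rewrite [leRHS]mulrDl (le_trans (ler_normD _ _))// !normrM lerD//.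
  by rewrite mulrAC ler_pM// ?HD//; exact: HK yz.
by rewrite -mulrA ler_pM// ?HC//; exact: HL yz.
Qed.

Lemma loclip_cst c : loclip (fun _ _ => c).
Proof. by apply: loclip_time => t; exact: cst_continuous. Qed.

Lemma loclipN f : loclip f -> loclip (fun t y => - f t y).
Proof.
move=> rf; have := loclipM (loclip_cst (-1)) rf.
rewrite (_ : (fun t y => -1 * f t y) = (fun t y => - f t y))//.
by apply/funext => t; apply/funext => y; rewrite mulN1r.
Qed.

Lemma loclipB f g : loclip f -> loclip g ->
  loclip (fun t y => f t y - g t y).
Proof. by move=> rf rg; apply: loclipD => //; exact: loclipN. Qed.

Lemma loclipX f n : loclip f -> loclip (fun t y => f t y ^+ n).
Proof.
move=> rf; elim: n => [|n IH].
  by under eq_fun do under eq_fun do rewrite expr0; exact: loclip_cst.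
by under eq_fun do under eq_fun do rewrite exprS; exact: loclipM.
Qed.

Lemma loclip_sum (J : Type) (r : seq J) (h : J -> R -> (I -> R) -> R) :
  (forall j, loclip (h j)) -> loclip (fun t y => \sum_(j <- r) h j t y).
Proof.
move=> rh; elim: r => [|j r IH].
  by under eq_fun do under eq_fun do rewrite big_nil; exact: loclip_cst.
by under eq_fun do under eq_fun do rewrite big_cons; exact: loclipD.
Qed.

Lemma ode_global_loclip (i0 : I) (F : I -> R -> (I -> R) -> R) (y0 : I -> R) (b : R -> R) :
  (forall i, loclip (F i)) -> continuous b -> (forall i, `|y0 i| <= b 0) ->
  (forall (T : R) (y : I -> R -> R), 0 < T -> (forall i, y i 0 = y0 i) ->
    (forall t : R, 0 <= t < T -> forall i, is_derive t 1 (y i) (F i t (y ^~ t))) ->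
    forall t, 0 <= t < T -> forall i, `|y i t| <= b t) ->
  exists y : I -> R -> R, (forall i, y i 0 = y0 i) /\
    (forall t : R, 0 <= t -> forall i, is_derive t 1 (y i) (F i t (y ^~ t))).
Proof.
move=> rF cb b0 ap; apply: ode_global ap => // [y cy i|T rho].
  by have [cF _] := rF i; exact: cF.
have H i : exists K : R, 0 <= K /\ forall t (y z : I -> R) c, 0 <= t <= T ->
     (forall j, `|y j| <= rho) -> (forall j, `|z j| <= rho) -> 0 <= c ->
     (forall j, `|y j - z j| <= c) -> `|F i t y - F i t z| <= K * c.
  by have [_ /(_ T rho)[K K0 HK]] := rF i; exists K.
have [K HK] := choice H.
have sK : 0 <= \sum_i K i by apply: sumr_ge0 => i _; exact: (HK i).1.
exists (\sum_i K i + 1) => [|t y z c tT yr zr yz i]; first by rewrite ltr_wpDl.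
have c0 : 0 <= c by rewrite (le_trans _ (yz i0)).
rewrite (le_trans ((HK i).2 t y z c _ _ _ _ _))// ler_wpM2r// (bigD1 i)//=.
rewrite -addrA lerDl addr_ge0// sumr_ge0// => j _; exact: (HK j).1.
Qed.

End locally_lipschitz.

(** * Scalar Lyapunov estimates *)

Section scalar_lyapunov.
Context {R : realType}.
Implicit Types (t c D T : R).

(** From time [c + K] on, [h' <= - K h + D], so [h] settles near [D / K]; as [K] is arbitrary, the
    limit is 0. *)
Lemma cvg_to0_increasing_damping (h dh : R -> R) c D : 0 <= D ->
  (forall t, 0 <= t -> 0 <= h t) ->
  (forall t, 0 <= t -> is_derive t 1 h (dh t)) ->
  (forall t, 0 <= t -> dh t <= (c - t) * h t + D) ->
  h t @[t --> +oo] --> (0 : R).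
Proof.
move=> D0 h0 h' hle; apply/cvgrPdist_le => e e0.
(* Chosen to give [D / K <= e / 2]; [D + 1] instead of [D] keeps [K] positive when [D = 0]. *)
pose K := 2 * (D + 1) / e.
have K0 : 0 < K by rewrite divr_gt0// mulr_gt0// ltr_wpDl.
have DK : D / K <= e / 2.
  rewrite ler_pdivrMr// /K (_ : e / 2 * (2 * (D + 1) / e) = D + 1); first by lra.
  by field; rewrite gt_eqF.
pose T := Num.max 0 (c + K).
have T0 : 0 <= T by rewrite le_max lexx.
have TK : c + K <= T by rewrite le_max lexx orbT.
have Z t : T <= t -> (h t - D / K) * expR (K * (t - T)) <= h T.
  move=> Tt.
  have E (s : R) : is_derive s 1 (fun s => expR (K * (s - T))) (K * expR (K * (s - T))).
    apply: is_derive_fexp.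
    have := is_derive_fmull K (is_derive_fsub (@is_derive_id R R s 1) (is_derive_fcst s T)).
    by rewrite subr0 mulr1.
  have := @is_derive_le0 _ (fun t => (h t - D / K) * expR (K * (t - T)))
    (fun s => (dh s - 0) * expR (K * (s - T)) + (h s - D / K) * (K * expR (K * (s - T)))) _ _ Tt.
  rewrite subrr mulr0 expR0 mulr1 => H; apply: le_trans (H _ _) _.
  - move=> s /andP[Ts _]; apply: is_derive_fmul (E s); apply: is_derive_fsub (is_derive_fcst _ _).
    by apply: h'; rewrite (le_trans T0).
  - move=> s /andP[Ts _]; rewrite subr0 mulrA -mulrDl pmulr_lle0 ?expR_gt0//.
    rewrite mulrBl divfK ?gt_eqF//.
    have s0 := le_trans T0 Ts; have := hle s s0; have hs := h0 s s0.
    have : (c - s) * h s <= - K * h s by apply: ler_wpM2r => //; lra.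
    lra.
  - by rewrite lerBlDr lerDl divr_ge0// ltW.
near=> t.
have tT : T <= t by near: t; apply: nbhs_pinfty_ge; exact: num_real.
rewrite sub0r normrN ger0_norm; last by rewrite h0// (le_trans T0).
rewrite leNgt; apply/negP => he.
(* At such a late time the bound [expR x >= 1 + x] is enough: if [h t > e], the decaying quantity
   [Z] would force [e / 2 + h T <= h T]. *)
have t1 : T + 2 * h T / e / K <= t by near: t; apply: nbhs_pinfty_ge; exact: num_real.
have h1 : 2 * h T / e <= K * (t - T) by rewrite [leRHS]mulrC -ler_pdivrMr// lerBrDl.
have h2 := Z t tT; have h3 := expR_ge1Dx (K * (t - T)).
have h4 : e / 2 * (1 + 2 * h T / e) <= h T.
  apply: le_trans h2; apply: ler_pM; [lra| |lra|lra].
  by rewrite addr_ge0// divr_ge0 ?(ltW e0)// mulr_ge0//; exact: h0.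
suff : e / 2 * (1 + 2 * h T / e) = e / 2 + h T by lra.
by field; rewrite gt_eqF.
Unshelve. all: by end_near. Qed.

(** * A priori bounds for the scaled energy *)

Section bounds.
Variables (E dE sg dsg rho : R -> R) (D T : R).
Hypothesis D0 : 0 <= D.
Hypothesis rho0 : 1 <= rho 0.
Hypothesis E0 : forall t, 0 <= t < T -> 0 <= E t.
Hypothesis E' : forall t, 0 <= t < T -> is_derive t 1 E (dE t).
Hypothesis sg' : forall t, 0 <= t < T -> is_derive t 1 sg (dsg t).
Hypothesis rho' : forall t, 0 <= t < T -> is_derive t 1 rho (rho t * (1 + sg t ^+ 2)).

(** The sign of [rho'] is that of [rho], so monotonicity cannot be used before positivity is known.
    The square is monotone in any case, and a change of sign would force a zero of [rho], where
    [rho ^+ 2 >= 1] fails. *)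
Lemma scaling_ge1 t : 0 <= t < T -> 1 <= rho t.
Proof.
move=> /andP[t0 tT].
have sub s : 0 <= s <= t -> 0 <= s < T by move=> /andP[-> /le_lt_trans->].
have rho2 s : 0 <= s <= t -> 1 <= rho s ^+ 2.
  move=> /andP[s0 st].
  have : 1 <= rho 0 ^+ 2 by rewrite expr_ge1// (le_trans _ rho0).
  move=> /le_trans; apply.
  apply: (@is_derive_ge0 _ (fun s => rho s ^+ 2) (fun s => 2 * rho s * (rho s * (1 + sg s ^+ 2)))) => //.
    move=> x /andP[x0 xs]; apply: is_derive_fsqr; apply: rho'.
    by apply: sub; rewrite x0 (le_trans xs).
  move=> x _; rewrite (_ : _ * _ = 2 * (rho x ^+ 2 * (1 + sg x ^+ 2))); last by ring.
  by rewrite mulr_ge0 // mulr_ge0 ?addr_ge0 ?sqr_ge0.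
have rt := rho2 t; rewrite lexx t0 in rt; have {}rt := rt isT.
have [r0|r0] := leP 0 (rho t); first by rewrite -(@ler_pXn2r _ 2)// ?nnegrE// expr1n.
have cr : {within `[0, t], continuous rho}.
  apply: derivable_within_continuous => x; rewrite in_itv/= => xt.
  by have [] := rho' (sub _ xt).
have r00 : 0 < rho 0 by rewrite (lt_le_trans _ rho0).
have [|c] := @IVT _ rho 0 t 0 t0 cr.
  by rewrite ge_min (ltW r0) orbT le_max (ltW r00).
rewrite in_itv/= => /rho2 + rc.
by rewrite rc expr0n/= ler10.
Qed.

Lemma unscaled_derive t : 0 <= t < T ->
  is_derive t 1 (fun t => rho t * expR (- t)) (sg t ^+ 2 * (rho t * expR (- t))).
Proof.
move=> tT; have := is_derive_fmul (rho' tT) (is_derive_expRN t).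
by rewrite (_ : _ + _ = sg t ^+ 2 * (rho t * expR (- t)))//; ring.
Qed.

Lemma unscaled_ge1 t : 0 <= t < T -> 1 <= rho t * expR (- t).
Proof.
move=> /andP[t0 tT]; have sub s : 0 <= s <= t -> 0 <= s < T by move=> /andP[-> /le_lt_trans->].
apply: le_trans rho0 _; rewrite -[leLHS]mulr1 -expR0 -[X in expR X]oppr0.
apply: (@is_derive_ge0 _ _ _ 0 t t0 (fun s st => unscaled_derive (sub s st))) => s /sub sT.
by rewrite mulr_ge0 ?sqr_ge0// mulr_ge0 ?expR_ge0// (le_trans _ (scaling_ge1 sT)).
Qed.

Lemma expR_le_scaling t : 0 <= t < T -> expR t <= rho t.
Proof. by move=> /unscaled_ge1; rewrite expRN ler_pdivlMr ?expR_gt0// mul1r. Qed.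

Hypothesis Ele : forall t, 0 <= t < T -> dE t <= (sg t ^+ 2 + 1 - 2 * rho t ^+ 2) * E t + D.
Hypothesis sgle : forall t, 0 <= t < T -> sg t * dsg t <= - sg t ^+ 2 + E t / rho t.

Let U t := E t / rho t + 2^-1 * sg t ^+ 2 + D * expR (- t).

Let U_ge0 t : 0 <= t < T -> 0 <= U t.
Proof.
move=> tT; rewrite !addr_ge0//.
- by rewrite divr_ge0 ?E0// (le_trans _ (scaling_ge1 tT)).
- by rewrite mulr_ge0 ?sqr_ge0// invr_ge0.
- by rewrite mulr_ge0 ?expR_ge0.
Qed.

(** Three cancellations: the growth rate [1 + sg^2] of [rho] against the positive coefficient in
    [Ele], the derivative of [D * expR (- t)] against [D / rho] because [expR t <= rho], and the
    forcing [E / rho] in [sgle] against the damping [2 * rho^2] because [rho >= 1]. *)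
Let U_derive t : 0 <= t < T -> exists2 dU : R, is_derive t 1 U dU & dU <= - sg t ^+ 2.
Proof.
move=> tT; have r1 := scaling_ge1 tT; have r0 : 0 < rho t by rewrite (lt_le_trans _ r1).
eexists.
  apply: is_derive_fadd (is_derive_fmull D (is_derive_expRN t)).
  apply: is_derive_fadd (is_derive_fmull 2^-1 (is_derive_fsqr (sg' tT))).
  apply: is_derive_fmul (E' tT) (is_derive_finv _ (rho' tT)).
  by rewrite gt_eqF.
set eta := E t / rho t.
have eta0 : 0 <= eta by rewrite divr_ge0 ?E0// ltW.
have h1 : dE t / rho t <= (sg t ^+ 2 + 1 - 2 * rho t ^+ 2) * eta + D / rho t.
  by rewrite /eta mulrA -mulrDl ler_pM2r ?invr_gt0// Ele.
have h2 : D / rho t <= D * expR (- t).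
  rewrite ler_wpM2l// expRN lef_pV2 ?posrE ?expR_gt0//; exact: expR_le_scaling.
have h3 : E t * (- (rho t * (1 + sg t ^+ 2)) / rho t ^+ 2) = - (1 + sg t ^+ 2) * eta.
  by rewrite /eta; field; rewrite gt_eqF.
have h4 : eta <= rho t ^+ 2 * eta by rewrite ler_peMl// expr_ge1// ltW.
have h5 := sgle tT; rewrite -/eta in h5.
have h6 : 2^-1 * (2 * sg t * dsg t) = sg t * dsg t by field.
rewrite h3 h6; nra.
Qed.

Let U_derive_choice : exists dU : R -> R,
  forall t, 0 <= t < T -> is_derive t 1 U (dU t) /\ dU t <= - sg t ^+ 2.
Proof.
have H t : exists d, 0 <= t < T -> is_derive t 1 U d /\ d <= - sg t ^+ 2.
  have [tT|] := pselect (0 <= t < T); last by exists 0.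
  by have [d] := U_derive tT; exists d.
by have [dU HU] := choice H; exists dU.
Qed.

Let U_le t : 0 <= t < T -> U t <= U 0.
Proof.
move=> /andP[t0 tT]; have sub s : 0 <= s <= t -> 0 <= s < T by move=> /andP[-> /le_lt_trans->].
have [dU HU] := U_derive_choice.
apply: (@is_derive_le0 _ U dU) => // s st; have [] := HU s (sub s st) => // _ /le_trans; apply.
by rewrite oppr_le0 sqr_ge0.
Qed.

Let U0E : U 0 = E 0 / rho 0 + 2^-1 * sg 0 ^+ 2 + D.
Proof. by rewrite /U oppr0 expR0 mulr1. Qed.

Lemma unscaled_le t : 0 <= t < T ->
  rho t * expR (- t) <= rho 0 * expR (E 0 / rho 0 + 2^-1 * sg 0 ^+ 2 + D).
Proof.
rewrite -U0E => tT'; have /andP[t0 tT] := tT'.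
have sub s : 0 <= s <= t -> 0 <= s < T by move=> /andP[-> /le_lt_trans->].
have [dU HU] := U_derive_choice.
pose z s := (rho s * expR (- s)) * expR (U s).
have : z t <= z 0.
  apply: (@is_derive_le0 _ z (fun s => (sg s ^+ 2 * (rho s * expR (- s))) * expR (U s) +
     (rho s * expR (- s)) * (dU s * expR (U s)))) => // s st.
    apply: is_derive_fmul (unscaled_derive (sub s st)) _.
    by apply: is_derive_fexp; have [] := HU s (sub s st).
  rewrite (_ : _ + _ = (rho s * expR (- s)) * expR (U s) * (sg s ^+ 2 + dU s)); last by ring.
  rewrite mulr_ge0_le0//.
    by rewrite !mulr_ge0 ?expR_ge0// (le_trans _ (scaling_ge1 (sub s st))).
  by have [] := HU s (sub s st) => // _; lra.
rewrite /z oppr0 expR0 mulr1; apply: le_trans.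
apply: ler_peMr; first exact: le_trans ler01 (unscaled_ge1 tT').
by rewrite -[leLHS]expR0 ler_expR U_ge0.
Qed.

Lemma energy_le t : 0 <= t < T ->
  E t <= (E 0 / rho 0 + 2^-1 * sg 0 ^+ 2 + D) * rho t.
Proof.
rewrite -U0E => tT; have r1 := scaling_ge1 tT; have r0 : 0 < rho t by rewrite (lt_le_trans _ r1).
rewrite -ler_pdivrMr//; apply: le_trans (U_le tT); rewrite /U -addrA lerDl addr_ge0//.
  by rewrite mulr_ge0 ?sqr_ge0// invr_ge0.
by rewrite mulr_ge0 ?expR_ge0.
Qed.

Lemma gain_mismatch_le t : 0 <= t < T ->
  sg t ^+ 2 <= 2 * (E 0 / rho 0 + 2^-1 * sg 0 ^+ 2 + D).
Proof.
rewrite -U0E => tT; have r1 := scaling_ge1 tT; have r0 : 0 < rho t by rewrite (lt_le_trans _ r1).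
have := U_le tT; rewrite {1}/U.
have : 0 <= E t / rho t by rewrite divr_ge0 ?E0// ltW.
have : 0 <= D * expR (- t) by rewrite mulr_ge0 ?expR_ge0.
lra.
Qed.

End bounds.

Lemma cvg_weighted_energy (E dE sg dsg rho F dF : R -> R) D : 0 <= D -> 1 <= rho 0 ->
  (forall t, 0 <= t -> 0 <= E t) -> (forall t, 0 <= t -> 0 <= F t) ->
  (forall t, 0 <= t -> is_derive t 1 E (dE t)) ->
  (forall t, 0 <= t -> is_derive t 1 F (dF t)) ->
  (forall t, 0 <= t -> is_derive t 1 sg (dsg t)) ->
  (forall t, 0 <= t -> is_derive t 1 rho (rho t * (1 + sg t ^+ 2))) ->
  (forall t, 0 <= t -> dE t <= (sg t ^+ 2 + 1 - 2 * rho t ^+ 2) * E t + D) ->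
  (forall t, 0 <= t -> sg t * dsg t <= - sg t ^+ 2 + E t / rho t) ->
  (forall t, 0 <= t -> dF t <= (sg t ^+ 2 + 1 - 2 * rho t ^+ 2 + E t) * F t + D) ->
  F t @[t --> +oo] --> (0 : R).
Proof.
move=> D0 rho0 E0 F0 E' F' sg' rho' Ele sgle Fle.
set C := E 0 / rho 0 + 2^-1 * sg 0 ^+ 2 + D.
pose s t := rho t * expR (- t).
have E0T T t : 0 <= t < T -> 0 <= E t by case/andP => /E0.
have E'T T t : 0 <= t < T -> is_derive t 1 E (dE t) by case/andP => /E'.
have sg'T T t : 0 <= t < T -> is_derive t 1 sg (dsg t) by case/andP => /sg'.
have rho'T T t : 0 <= t < T -> is_derive t 1 rho (rho t * (1 + sg t ^+ 2)) by case/andP => /rho'.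
have EleT T t : 0 <= t < T -> dE t <= (sg t ^+ 2 + 1 - 2 * rho t ^+ 2) * E t + D by case/andP => /Ele.
have sgleT T t : 0 <= t < T -> sg t * dsg t <= - sg t ^+ 2 + E t / rho t by case/andP => /sgle.
have tT t : 0 <= t -> 0 <= t < t + 1 by move=> ->; rewrite ltrDl ltr01.
have s' t : 0 <= t -> is_derive t 1 s (sg t ^+ 2 * s t).
  by move=> /tT; exact: (unscaled_derive (@rho'T _)).
have s1 t : 0 <= t -> 1 <= s t.
  by move=> /tT; exact: (unscaled_ge1 rho0 (@rho'T _)).
have sC t : 0 <= t -> s t <= rho 0 * expR C.
  by move=> /tT; exact: (unscaled_le D0 rho0 (@E0T _) (@E'T _) (@sg'T _) (@rho'T _) (@EleT _) (@sgleT _)).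
have EC t : 0 <= t -> E t <= C * rho t.
  by move=> /tT; exact: (energy_le D0 rho0 (@E0T _) (@E'T _) (@sg'T _) (@rho'T _) (@EleT _) (@sgleT _)).
have er t : 0 <= t -> expR t <= rho t.
  by move=> /tT; exact: (expR_le_scaling rho0 (@rho'T _)).
(* The logarithmic derivative of [s] is [sg ^+ 2], so dividing by [s] removes [sg] from the rate of
   [F]; since [1 <= s <= rho 0 * expR C], nothing is lost. *)
pose h t := F t / s t.
have h0 t : 0 <= t -> 0 <= h t.
  by move=> t0; rewrite divr_ge0 ?F0// (le_trans ler01 (s1 t t0)).
have hc : h t @[t --> +oo] --> (0 : R).
  apply: (@cvg_to0_increasing_damping h
    (fun t => dF t / s t + F t * (- (sg t ^+ 2 * s t) / s t ^+ 2)) (1 + C ^+ 2) D) => //.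
    move=> t t0; have st := s1 t t0; apply: is_derive_fmul (F' t t0) (is_derive_finv _ (s' t t0)).
    by rewrite gt_eqF// (lt_le_trans ltr01).
  move=> t t0; have st := s1 t t0; have st0 : 0 < s t by rewrite (lt_le_trans ltr01).
  have ht := h0 t t0.
  rewrite (_ : F t * _ = - sg t ^+ 2 * h t); last by rewrite /h; field; rewrite gt_eqF.
  have h1 : dF t / s t <= (sg t ^+ 2 + 1 - 2 * rho t ^+ 2 + E t) * h t + D / s t.
    by rewrite /h mulrA -mulrDl ler_pM2r ?invr_gt0// Fle.
  have h2 : D / s t <= D by rewrite ler_pdivrMr// ler_peMr.
  have h3 := EC t t0.
  have h4 : t <= rho t by rewrite (le_trans _ (er t t0))// (le_trans _ (expR_ge1Dx t))// lerDr.
  have h5 : 1 <= rho t by rewrite (le_trans _ (er t t0))// -[leLHS]expR0 ler_expR.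
  (* The additional [E] in the rate of [F] grows at most like [C * rho], hence is beaten by
     [rho ^+ 2], which also dominates [t]. *)
  have h6 : 1 - 2 * rho t ^+ 2 + E t <= 1 + C ^+ 2 - t.
    have k1 := sqr_ge0 (C - rho t); have k2 := sqr_ge0 C.
    have k3 : rho t <= rho t ^+ 2 by rewrite expr2 ler_peMl// (le_trans ler01).
    lra.
  have h7 := ler_wpM2r ht h6.
  lra.
have : rho 0 * expR C * h t @[t --> +oo] --> rho 0 * expR C * 0 by apply: cvgMr.
rewrite mulr0 => hC.
apply: (@squeeze_cvgr _ _ _ _ (fun=> 0) (fun t => rho 0 * expR C * h t)) => //; last exact: cvg_cst.
near=> t; have t0 : 0 <= t by near: t; apply: nbhs_pinfty_ge; exact: num_real.
rewrite F0//=; have st := s1 t t0.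
rewrite (_ : F t = s t * h t); first by rewrite ler_wpM2r ?h0 ?sC.
by rewrite /h mulrCA divff ?mulr1// gt_eqF// (lt_le_trans ltr01).
Unshelve. all: by end_near. Qed.

End scalar_lyapunov.

(** * Quadratic forms *)

Section quadratic_forms.
Context {R : realType} {n : nat}.
Implicit Types (A M P : 'M[R]_n) (x y z : 'cV[R]_n).

Definition bil A x y : R := \sum_i \sum_j x i 0 * A i j * y j 0.

Definition sqn x : R := \sum_i x i 0 ^+ 2.

Lemma bilE A x y : bil A x y = (x^T *m A *m y) 0 0.
Proof.
rewrite mxE; under [RHS]eq_bigr do rewrite mxE big_distrl/=.
rewrite exchange_big/=; apply: eq_bigr => i _; apply: eq_bigr => j _.
by rewrite mxE.
Qed.

Lemma bil_mulmx A x y : bil A x y = \sum_i x i 0 * (A *m y) i 0.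
Proof.
apply: eq_bigr => i _; rewrite mxE big_distrr/=; apply: eq_bigr => j _.
by rewrite mulrA.
Qed.

Lemma bilDl A x x' y : bil A (x + x') y = bil A x y + bil A x' y.
Proof. by rewrite !bilE linearD/= !mulmxDl mxE. Qed.

Lemma bilDr A x y y' : bil A x (y + y') = bil A x y + bil A x y'.
Proof. by rewrite !bilE mulmxDr mxE. Qed.

Lemma bilZl A a x y : bil A (a *: x) y = a * bil A x y.
Proof. by rewrite !bilE linearZ/= -!scalemxAl mxE. Qed.

Lemma bilZr A a x y : bil A x (a *: y) = a * bil A x y.
Proof. by rewrite !bilE -scalemxAr mxE. Qed.

Lemma bilBl A x x' y : bil A (x - x') y = bil A x y - bil A x' y.
Proof. by rewrite bilDl -scaleN1r bilZl mulN1r. Qed.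

Lemma bilBr A x y y' : bil A x (y - y') = bil A x y - bil A x y'.
Proof. by rewrite bilDr -scaleN1r bilZr mulN1r. Qed.

Lemma bilDm A A' x y : bil (A + A') x y = bil A x y + bil A' x y.
Proof. by rewrite !bilE mulmxDr mulmxDl mxE. Qed.

Lemma bil_sym A x y : A^T = A -> bil A x y = bil A y x.
Proof.
move=> sA; rewrite /bil exchange_big; apply: eq_bigr => i _; apply: eq_bigr => j _.
by rewrite -{1}sA mxE mulrC mulrA mulrAC mulrC mulrA [x j 0 * _]mulrC.
Qed.

Lemma sqn_ge0 x : 0 <= sqn x.
Proof. by apply: sumr_ge0 => i _; exact: sqr_ge0. Qed.

Lemma sqn_coord x i : x i 0 ^+ 2 <= sqn x.
Proof. by rewrite /sqn (bigD1 i)//= lerDl sumr_ge0// => j _; exact: sqr_ge0. Qed.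

Lemma posdef_ge0 M x : sym_posdef M -> 0 <= bil M x x.
Proof.
move=> [_ M0]; have [->|/M0/ltW] := eqVneq x 0; last by rewrite bilE.
by rewrite bilE mulmx0 mxE.
Qed.

Lemma posdef_cauchy_schwarz M x y : sym_posdef M ->
  bil M x y ^+ 2 <= bil M x x * bil M y y.
Proof.
move=> Mp; have [sM M0] := Mp.
have z u : bil M u 0 = 0 by rewrite bilE mulmx0 mxE.
have [->|y0] := eqVneq y 0; first by rewrite !z expr0n mulr0.
have c0 : 0 < bil M y y by rewrite bilE M0.
(* With [a], [b], [c] as below, the form at [c x - b y] equals [c (a c - b^2)], and [c > 0] can be
   divided out. *)
have := posdef_ge0 (bil M y y *: x - bil M x y *: y) Mp.
rewrite !(bilBl, bilBr, bilZl, bilZr) (bil_sym y x sM).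
set a := bil M x x; set b := bil M x y; set c := bil M y y => H.
have : 0 <= c * (a * c - b ^+ 2).
  by rewrite (_ : _ * _ = c * (c * a) - c * (b * b) - b * (c * b) + b * (b * c) + 0) in H *; lra.
by rewrite pmulr_rge0// subr_ge0.
Qed.

Lemma posdef_unit M : sym_posdef M -> M \in unitmx.
Proof.
move=> [sM M0]; rewrite -row_free_unit -kermx_eq0; apply/eqP/row_matrixP => i.
rewrite row0; apply/eqP; apply: contraT => k0.
have kM : row i (kermx M) *m M = 0 by rewrite -row_mul mulmx_ker row0.
have := M0 (row i (kermx M))^T; rewrite trmxK kM mul0mx mxE ltxx => H.
have/H// : (row i (kermx M))^T != 0 by apply: contra k0 => /eqP e0; rewrite -[row _ _]trmxK e0 trmx0.
Qed.

Lemma posdef_mulV M : sym_posdef M -> M *m invmx M = 1%:M.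
Proof. by move=> /posdef_unit; exact: mulmxV. Qed.

Lemma invmx_sym M : M^T = M -> (invmx M)^T = invmx M.
Proof. by move=> sM; rewrite trmx_inv sM. Qed.

(** Cauchy-Schwarz for the inner product of [M]: the coordinate [x_i] is the product of [x] with
    [M^-1 e_i], whose square norm is the diagonal entry of [M^-1]. Unlike the largest eigenvalue of
    [M^-1], the trace gives a weight that is smooth in [q]. *)
Lemma sqn_le_invmx M x : sym_posdef M -> sqn x <= \tr (invmx M) * bil M x x.
Proof.
move=> Mp; have Mu := posdef_unit Mp.
rewrite /mxtrace big_distrl; apply: ler_sum => i _ /=.
pose e : 'cV[R]_n := invmx M *m delta_mx i 0.
have -> : x i 0 = bil M e x.
  rewrite bilE /e trmx_mul invmx_sym ?Mp.1// mulmxKV// trmx_delta.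
  by rewrite -rowE mxE.
have -> : invmx M i i = bil M e e.
  rewrite bilE {1}/e trmx_mul invmx_sym ?Mp.1// mulmxKV// trmx_delta /e mulmxA.
  by rewrite -rowE -colE !mxE.
exact: posdef_cauchy_schwarz.
Qed.

Lemma sqn_mulmx_le M x : sym_posdef M -> sqn (M *m x) <= \tr M * bil M x x.
Proof.
move=> Mp; rewrite /mxtrace big_distrl; apply: ler_sum => i _ /=.
have -> : (M *m x) i 0 = bil M (delta_mx i 0) x.
  by rewrite bilE trmx_delta -mulmxA -rowE [RHS]mxE.
have -> : M i i = bil M (delta_mx i 0) (delta_mx i 0).
  by rewrite bilE trmx_delta -rowE -colE !mxE.
exact: posdef_cauchy_schwarz.
Qed.

Lemma posdef_tr_ge0 M : sym_posdef M -> 0 <= \tr M.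
Proof.
move=> Mp; apply: sumr_ge0 => i _.
rewrite (_ : M i i = bil M (delta_mx i 0) (delta_mx i 0)) ?posdef_ge0//.
by rewrite bilE trmx_delta -rowE -colE !mxE.
Qed.

Lemma posdef_inv M : sym_posdef M -> sym_posdef (invmx M).
Proof.
move=> Mp; have Mu := posdef_unit Mp; split; first exact: invmx_sym Mp.1.
move=> x x0; have := Mp.2 (invmx M *m x); rewrite trmx_mul invmx_sym ?Mp.1//.
rewrite !mulmxA mulmxKV// => H; apply: H; apply: contra x0 => /eqP H.
by rewrite -[x](mulKVmx Mu) H mulmx0.
Qed.

End quadratic_forms.

(** * The energy of the velocity error *)

Section energy.
Context {R : realType} {n : nat}.
Implicit Types (M P : 'M[R]_n) (Gam : 'I_n -> 'M[R]_n) (a v w d x y z : 'cV[R]_n).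

(** When [Gam l] is the partial derivative of [M] along the coordinate [l] of [q], this is the
    derivative of [M] in the direction [x]. *)
Definition dirm Gam x : 'M[R]_n := \sum_l x l 0 *: Gam l.

(** The Coriolis and centrifugal force at velocity [a]: the derivative of [M] along [a] applied to
    [a], minus half the gradient in [q] of [a^T M a]. *)
Definition coriolis Gam a : 'cV[R]_n :=
  \col_i ((dirm Gam a *m a) i 0 - 2^-1 * bil (Gam i) a a).

Definition dot x y : R := \sum_i x i 0 * y i 0.

Definition sumsq Gam : R := \sum_l \sum_i \sum_j Gam l i j ^+ 2.

Lemma dotDr x y z : dot x (y + z) = dot x y + dot x z.
Proof. by rewrite -big_split; apply: eq_bigr => i _; rewrite mxE mulrDr. Qed.

Lemma dotZr c x y : dot x (c *: y) = c * dot x y.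
Proof. by rewrite /dot big_distrr; apply: eq_bigr => i _; rewrite mxE mulrCA. Qed.

Lemma dotBr x y z : dot x (y - z) = dot x y - dot x z.
Proof. by rewrite dotDr -scaleN1r dotZr mulN1r. Qed.

Lemma bil_dirm Gam x y z : bil (dirm Gam x) y z = \sum_l x l 0 * bil (Gam l) y z.
Proof.
rewrite bilE /dirm mulmx_sumr mulmx_suml summxE; apply: eq_bigr => l _.
by rewrite -scalemxAr -scalemxAl mxE bilE.
Qed.

Lemma dirmD Gam x y : dirm Gam (x + y) = dirm Gam x + dirm Gam y.
Proof. by rewrite -big_split; apply: eq_bigr => l _; rewrite mxE scalerDl. Qed.

Lemma dirm_sym Gam x : (forall l, (Gam l)^T = Gam l) -> (dirm Gam x)^T = dirm Gam x.
Proof.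
by move=> sG; rewrite /dirm linear_sum; apply: eq_bigr => l _; rewrite linearZ/= sG.
Qed.

Lemma dot_coriolis Gam w a :
  dot w (coriolis Gam a) = bil (dirm Gam a) w a - 2^-1 * bil (dirm Gam w) a a.
Proof.
rewrite bil_mulmx bil_dirm big_distrr -sumrB; apply: eq_bigr => i _ /=.
by rewrite mxE mulrBr; congr (_ - _); rewrite mulrCA.
Qed.

(* The Christoffel structure of [coriolis] makes the terms quadratic in [v]
   cancel: only the measured [v + w] is left. *)
Lemma energy_rate M P Gam v w d (r : 'rV[R]_n) (g : R) :
  M^T = M -> (forall l, (Gam l)^T = Gam l) -> M *m P = 1%:M ->
  bil M w (P *m (coriolis Gam v - coriolis Gam (v + w) - diag_mx r *m w - d) - g *: w)
    + 2^-1 * bil (dirm Gam v) w w =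
  - 2^-1 * bil (dirm Gam (v + w)) w w - \sum_i r 0 i * w i 0 ^+ 2 - dot w d - g * bil M w w.
Proof.
move=> sM sG MP.
rewrite bilBr bilZr bil_mulmx mulmxA MP mul1mx -/(dot _ _) !dotBr !dot_coriolis.
have -> : dot w (diag_mx r *m w) = \sum_i r 0 i * w i 0 ^+ 2.
  by apply: eq_bigr => i _; rewrite mul_diag_mx mxE mulrCA expr2.
rewrite !(dirmD, bilDm, bilDl, bilDr) (bil_sym v w (dirm_sym w sG)).
by field.
Qed.

(** Each of the [n^3] terms is split by [2 |x y| <= x^2 + y^2] into a part in [a] and a part in
    [Gam]; the factor [n ^+ 2] counts the index pairs over which [a_l^2] is repeated. The bound is
    crude but smooth in [q]. *)
Lemma bil_dirm_le Gam a w : `|bil (dirm Gam a) w w| <=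
  2^-1 * ((n%:R ^+ 2 + sumsq Gam) * (1 + sqn a)) * sqn w.
Proof.
have S0 : 0 <= sumsq Gam.
  by apply: sumr_ge0 => l _; apply: sumr_ge0 => i _; apply: sumr_ge0 => j _; exact: sqr_ge0.
have a0 := sqn_ge0 a; have w0 := sqn_ge0 w.
apply: (@le_trans _ _ (\sum_l \sum_i \sum_j 2^-1 * (a l 0 ^+ 2 + Gam l i j ^+ 2) * sqn w)).
  rewrite bil_dirm (le_trans (ler_norm_sum _ _ _))// ler_sum// => l _.
  rewrite /bil big_distrr (le_trans (ler_norm_sum _ _ _))// ler_sum// => i _ /=.
  rewrite big_distrr (le_trans (ler_norm_sum _ _ _))// ler_sum// => j _ /=.
  have wi := sqn_coord w i; have wj := sqn_coord w j.
  rewrite (_ : _ * _ = (a l 0 * Gam l i j) * (w i 0 * w j 0)); last by ring.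
  have k (x y : R) : `|x * y| <= 2^-1 * (x ^+ 2 + y ^+ 2).
    have := sqr_ge0 (x - y); have := sqr_ge0 (x + y); rewrite ler_norml => ? ?.
    by apply/andP; split; lra.
  rewrite normrM ler_pM//.
  by rewrite (le_trans (k _ _))//; lra.
have cst_sum (c : R) (f : 'I_n -> R) :
    \sum_i 2^-1 * (c + f i) * sqn w = 2^-1 * (n%:R * c + \sum_i f i) * sqn w.
  by rewrite -big_distrl -big_distrr big_split/= sumr_const card_ord mulr_natl.
under eq_bigr => l _.
  under eq_bigr => i _ do rewrite cst_sum.
  rewrite cst_sum; over.
rewrite -big_distrl -big_distrr big_split/= -/(sumsq Gam).
rewrite ler_wpM2r// ler_wpM2l ?invr_ge0//.
rewrite (_ : \sum_i _ = n%:R ^+ 2 * sqn a); last first.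
  rewrite /sqn big_distrr; apply: eq_bigr => i _ /=.
  by rewrite mulrA expr2.
have : 0 <= n%:R ^+ 2 :> R by rewrite sqr_ge0.
by have := mulr_ge0 S0 a0; nra.
Qed.

Lemma dot_young x y (c : R) : 0 < c -> `|dot x y| <= 2^-1 * (c * sqn x + sqn y / c).
Proof.
move=> c0; apply: (@le_trans _ _ (\sum_i 2^-1 * (c * x i 0 ^+ 2 + y i 0 ^+ 2 / c))).
  rewrite (le_trans (ler_norm_sum _ _ _))// ler_sum// => i _.
  set s := x i 0; set t := y i 0.
  have := sqr_ge0 (c * s - t); have := sqr_ge0 (c * s + t) => h1 h2.
  rewrite -(@ler_pM2l _ (2 * c)) ?mulr_gt0//.
  rewrite (_ : 2 * c * (2^-1 * (c * s ^+ 2 + t ^+ 2 / c)) = c ^+ 2 * s ^+ 2 + t ^+ 2); last first.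
    by field; rewrite gt_eqF.
  have c2 : 0 <= 2 * c by rewrite mulr_ge0// ltW.
  rewrite -{1}(ger0_norm c2) -normrM ler_norml.
  by apply/andP; split; lra.
by rewrite -big_distrr big_split/= -big_distrr -big_distrl.
Qed.

(** For [P = M^-1] this factor converts [|w|^2] into the energy. The summand 1 keeps it at least 1,
    so that it can be divided by. *)
Definition inertia_bound (P : 'M[R]_n) : R := 1 + \tr P.

Definition gain_weight (P : 'M[R]_n) Gam (mu : R) (dmu : 'cV[R]_n) : R :=
  inertia_bound P * (n%:R ^+ 2 + sumsq Gam + mu + 1 + sqn dmu).

(** * Dissipation inequalities *)

Section rates.
Variables (M : 'M[R]_n) (Gam : 'I_n -> 'M[R]_n) (v w d dmu : 'cV[R]_n) (r : 'rV[R]_n).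
Variables (mu sg rho : R).
Hypothesis Mp : sym_posdef M.
Hypothesis sG : forall l, (Gam l)^T = Gam l.
Hypothesis r0 : forall i, 0 <= r 0 i.
Hypothesis mu1 : 1 <= mu.

Local Notation P := (invmx M).
Local Notation tau := (inertia_bound P).
Local Notation alpha := (gain_weight P Gam mu dmu).
Local Notation g := (alpha * (1 + sqn (v + w)) + sg + rho ^+ 2).
Local Notation E := (2^-1 * bil M w w).
Local Notation dE :=
  (bil M w (P *m (coriolis Gam v - coriolis Gam (v + w) - diag_mx r *m w - d) - g *: w)
    + 2^-1 * bil (dirm Gam v) w w).

Let tau1 : 1 <= tau.
Proof. by rewrite /inertia_bound lerDl posdef_tr_ge0//; exact: posdef_inv. Qed.

Let E0 : 0 <= E. Proof. by rewrite mulr_ge0 ?invr_ge0// posdef_ge0. Qed.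

Lemma sqn_le_energy : sqn w <= 2 * tau * E.
Proof.
apply: le_trans (sqn_le_invmx w Mp) _.
rewrite (_ : _ * E = tau * bil M w w); last by field.
by rewrite /inertia_bound mulrDl mul1r lerDr posdef_ge0.
Qed.

Let S0 : 0 <= sumsq Gam.
Proof.
by apply: sumr_ge0 => l _; apply: sumr_ge0 => i _; apply: sumr_ge0 => j _; exact: sqr_ge0.
Qed.

(** The gain supplies [alpha (1 + |v + w|^2) E] twice. One copy absorbs the velocity-dependent form
    and the Young term of the disturbance; the other stays in the bound, in reserve for the drift of
    [mu] in [weighted_rate_le]. *)
Lemma energy_rate_le : dE <= (sg ^+ 2 + 1 - 2 * rho ^+ 2) * E + 2^-1 * sqn d / mu
   - alpha * (1 + sqn (v + w)) * E.
Proof.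
rewrite energy_rate ?posdef_mulV//; last exact: Mp.1.
set V := 1 + sqn (v + w).
have V1 : 1 <= V by rewrite lerDl sqn_ge0.
have mu0 : 0 < mu by rewrite (lt_le_trans _ mu1).
have h1 := bil_dirm_le Gam (v + w) w; rewrite -/V ler_norml in h1.
have h2 : 0 <= \sum_i r 0 i * w i 0 ^+ 2.
  by apply: sumr_ge0 => i _; rewrite mulr_ge0 ?sqr_ge0.
have := dot_young w d mu0; rewrite ler_norml => /andP[h3 _].
have n0 : 0 <= n%:R ^+ 2 :> R by rewrite sqr_ge0.
set N := n%:R ^+ 2 + sumsq Gam in h1 *.
have N0 : 0 <= N by rewrite addr_ge0.
have h4 : 2^-1 * (N * V) * sqn w <= N * V * (tau * E).
  have := ler_wpM2l (mulr_ge0 N0 (le_trans ler01 V1)) sqn_le_energy; lra.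
have h5 : 2^-1 * (mu * sqn w) <= mu * (tau * E).
  have := ler_wpM2l (ltW mu0) sqn_le_energy; lra.
have h6 : (N + mu) * V * (tau * E) <= alpha * V * E.
  rewrite (_ : alpha * V * E = (N + mu + 1 + sqn dmu) * V * (tau * E)); last first.
    by rewrite /gain_weight -/N; ring.
  have tE : 0 <= tau * E by rewrite mulr_ge0 // (le_trans ler01).
  rewrite ler_wpM2r// ler_wpM2r ?(le_trans ler01)//.
  by have := sqn_ge0 dmu; lra.
have h7 : mu * (tau * E) <= mu * V * (tau * E).
  by rewrite ler_wpM2r ?ler_peMr ?(ltW mu0)// mulr_ge0// (le_trans ler01).
have h8 : - (2 * sg) * E <= (sg ^+ 2 + 1) * E.
  by apply: ler_wpM2r => //; have := sqr_ge0 (sg + 1); lra.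
have V0 : 0 <= V by rewrite (le_trans ler01).
have h9 : 0 <= N * V * (tau * E) by apply: mulr_ge0; apply: mulr_ge0 => //; rewrite (le_trans ler01).
case/andP: h1 => h1 _.
rewrite (_ : g * bil M w w = 2 * (alpha * V * E) + (2 * sg) * E + 2 * rho ^+ 2 * E); last first.
  by rewrite -/V; field.
lra.
Qed.

(** The velocity in the drift of [mu] is split as [(v + w) - w]. The first part is paid by the copy
    kept in [energy_rate_le]; the part in [w] costs a further [E], which is why [E] enters the rate
    on the right. *)
Lemma weighted_rate_le : mu * dE + dot dmu v * E <=
  (sg ^+ 2 + 1 - 2 * rho ^+ 2 + E) * (mu * E) + 2^-1 * sqn d.
Proof.
have mu0 : 0 < mu by rewrite (lt_le_trans _ mu1).
have h1 := ler_wpM2l (ltW mu0) energy_rate_le.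
move: h1; set e := E; set V := 1 + sqn (v + w); set X := dE => h1.
have V1 : 1 <= V by rewrite lerDl sqn_ge0.
have tau0 : 0 < tau by rewrite (lt_le_trans _ tau1).
have s0 := sqn_ge0 dmu.
have := @dot_young dmu (v + w) 1 ltr01; rewrite ler_norml => /andP[_ h2].
have := dot_young dmu w tau0; rewrite ler_norml => /andP[h3 _].
have h4 : sqn w / tau <= 2 * e by rewrite ler_pdivrMr// mulrAC sqn_le_energy.
have h5 : tau * (1 + sqn dmu) <= alpha.
  rewrite /gain_weight ler_wpM2l ?(ltW tau0)//.
  by have : 0 <= n%:R ^+ 2 :> R by [rewrite sqr_ge0]; move: S0 mu0; lra.
have h6 : tau * (1 + sqn dmu) * V <= alpha * V by rewrite ler_wpM2r// (le_trans ler01).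
have h7 : 1 + sqn dmu <= tau * (1 + sqn dmu) by rewrite ler_peMl// addr_ge0.
have h8 : (1 + sqn dmu) * V <= tau * (1 + sqn dmu) * V by rewrite ler_wpM2r// (le_trans ler01).
have h9 : tau * sqn dmu <= tau * (1 + sqn dmu) * V.
  have : tau * (1 + sqn dmu) <= tau * (1 + sqn dmu) * V.
    by rewrite ler_peMr// mulr_ge0 ?(ltW tau0)// addr_ge0.
  move: tau0; lra.
have h10 : sqn dmu + sqn (v + w) <= (1 + sqn dmu) * V.
  have := mulr_ge0 s0 (sqn_ge0 (v + w)); rewrite /V; lra.
have h11 : dot dmu v <= alpha * V + e.
  have -> : dot dmu v = dot dmu (v + w) - dot dmu w by rewrite dotDr addrK.
  lra.
have h12 := ler_wpM2r E0 h11; rewrite -/e in h12.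
have h13 : alpha * V * e <= mu * (alpha * V * e).
  rewrite ler_peMl// mulr_ge0//.
  by rewrite mulr_ge0 ?(le_trans ler01 V1)// (le_trans _ h5)// mulr_ge0 ?(ltW tau0)// addr_ge0.
have h14 : e * e <= e * (mu * e) by rewrite ler_wpM2l ?ler_peMl// E0.
have h15 : mu * (2^-1 * sqn d / mu) = 2^-1 * sqn d by field; rewrite gt_eqF.
lra.
Qed.

(** Young's inequality with weight [tau * rho]: the part in [sg * a] is covered by the feedback, and
    [|w|^2 / (tau * rho)] is at most [2 * E / rho]. *)
Lemma mismatch_rate_le a : 1 <= rho ->
  sg * (- ((1 + tau * rho * sqn a) * sg) + dot a w) <= - sg ^+ 2 + E / rho.
Proof.
move=> rho1; have rho0 : 0 < rho by rewrite (lt_le_trans _ rho1).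
have tau0 : 0 < tau by rewrite (lt_le_trans _ tau1).
have dotZl c x y : dot (c *: x) y = c * dot x y.
  by rewrite /dot big_distrr/=; apply: eq_bigr => i _; rewrite mxE mulrA.
have sqnZ c x : sqn (c *: x) = c ^+ 2 * sqn x.
  by rewrite /sqn big_distrr/=; apply: eq_bigr => i _; rewrite mxE exprMn.
have := dot_young (sg *: a) w (mulr_gt0 tau0 rho0); rewrite ler_norml dotZl sqnZ => /andP[_ h].
have h4 : sqn w / (tau * rho) <= 2 * (E / rho).
  rewrite ler_pdivrMr ?mulr_gt0// (le_trans sqn_le_energy)// le_eqVlt; apply/orP; left; apply/eqP.
  by field; rewrite gt_eqF.
have h5 : 0 <= tau * rho * (sg ^+ 2 * sqn a).
  by apply: mulr_ge0; rewrite mulr_ge0 ?sqn_ge0 ?sqr_ge0 ?ltW.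
lra.
Qed.

End rates.

End energy.

(** * The error system *)

Section loclip_vector.
Context {R : realType} {I : finType} {n : nat}.
Implicit Types (f g : R -> (I -> R) -> 'cV[R]_n) (s : R -> (I -> R) -> R).

Definition vloclip f := forall i, loclip (fun t y => f t y i 0).

Lemma eq_loclip (s s' : R -> (I -> R) -> R) : (forall t y, s' t y = s t y) ->
  loclip s -> loclip s'.
Proof.
by move=> ss'; rewrite (_ : s' = s)//; apply/funext => t; apply/funext => y.
Qed.

Lemma vloclip_time (g : R -> 'cV[R]_n) : (forall i, continuous (fun t => g t i 0)) ->
  vloclip (fun t _ => g t).
Proof. by move=> cg i; exact: loclip_time. Qed.

Lemma vloclipD f g : vloclip f -> vloclip g ->
  vloclip (fun t y => f t y + g t y).
Proof.
by move=> cf cg i; apply: eq_loclip (loclipD (cf i) (cg i)) => t y; rewrite mxE.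
Qed.

Lemma vloclipZ s f : loclip s -> vloclip f ->
  vloclip (fun t y => s t y *: f t y).
Proof.
by move=> cs cf i; apply: eq_loclip (loclipM cs (cf i)) => t y; rewrite mxE.
Qed.

Lemma vloclipB f g : vloclip f -> vloclip g ->
  vloclip (fun t y => f t y - g t y).
Proof.
by move=> cf cg i; apply: eq_loclip (loclipB (cf i) (cg i)) => t y; rewrite !mxE.
Qed.

Lemma vloclip_mulmx (A : R -> 'M[R]_n) f : (forall i j, continuous (fun t => A t i j)) ->
  vloclip f -> vloclip (fun t y => A t *m f t y).
Proof.
move=> cA cf i; apply: (@eq_loclip (fun t y => \sum_j A t i j * f t y j 0)) => [t y|].
  by rewrite mxE.
by apply: loclip_sum => j; apply: loclipM => //; exact: loclip_time.
Qed.

Lemma loclip_dot f g : vloclip f -> vloclip g ->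
  loclip (fun t y => dot (f t y) (g t y)).
Proof. by move=> cf cg; apply: loclip_sum => i; exact: loclipM. Qed.

Lemma loclip_sqn f : vloclip f -> loclip (fun t y => sqn (f t y)).
Proof. by move=> cf; apply: loclip_sum => i; exact: loclipX. Qed.

Lemma vloclip_coriolis (Gam : R -> 'I_n -> 'M[R]_n) f :
  (forall l i j, continuous (fun t => Gam t l i j)) -> vloclip f ->
  vloclip (fun t y => coriolis (Gam t) (f t y)).
Proof.
move=> cG cf i; apply: (@eq_loclip (fun t y =>
    \sum_j (\sum_l f t y l 0 * Gam t l i j) * f t y j 0 -
    2^-1 * \sum_k \sum_j f t y k 0 * Gam t i k j * f t y j 0)) => [t y|].
  rewrite /coriolis !mxE; congr (_ - _); apply: eq_bigr => j _; rewrite summxE.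
  by congr (_ * _); apply: eq_bigr => l _; rewrite mxE.
apply: loclipB.
  apply: loclip_sum => j; apply: loclipM (cf j); apply: loclip_sum => l.
  by apply: loclipM (cf l) _; exact: loclip_time.
apply: loclipM; first exact: loclip_cst.
apply: loclip_sum => k; apply: loclip_sum => j.
by apply: loclipM (cf j); apply: loclipM (cf k) _; exact: loclip_time.
Qed.

End loclip_vector.

Section error_system.
Context {R : realType} {n : nat}.
Variables (M : R -> 'M[R]_n) (Gam : R -> 'I_n -> 'M[R]_n) (v dmu dal : R -> 'cV[R]_n).
Variables (mu : R -> R) (d : 'cV[R]_n) (r : 'rV[R]_n).
Local Notation P t := (invmx (M t)).
Local Notation tau t := (inertia_bound (P t)).
Local Notation al t := (gain_weight (P t) (Gam t) (mu t) (dmu t)).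

Definition innovation_gain t (w : 'cV[R]_n) (sg rho : R) :=
  al t * (1 + sqn (v t + w)) + sg + rho ^+ 2.

(** Minus the coefficient of [w] in the derivative of the target [al (1 + |vh|^2)]. The first
    summand comes from [q' = vh - w], the second from the innovation [- g w] in the derivative of
    [vh]. *)
Definition mismatch_dir t (w : 'cV[R]_n) (sg rho : R) :=
  (1 + sqn (v t + w)) *: dal t + (2 * al t * innovation_gain t w sg rho) *: (v t + w).

Definition error_field t (w : 'cV[R]_n) (sg rho : R) :=
  P t *m (coriolis (Gam t) (v t) - coriolis (Gam t) (v t + w) - diag_mx r *m w - d)
  - innovation_gain t w sg rho *: w.

Definition mismatch_field t (w : 'cV[R]_n) (sg rho : R) :=
  - ((1 + tau t * rho * sqn (mismatch_dir t w sg rho)) * sg) + dot (mismatch_dir t w sg rho) w.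

(* [w] is the velocity error, [sg] the gap between the gain state and the gain
   it should follow, and [rho] the dynamic scaling. *)
Definition error_solution T (w : R -> 'cV[R]_n) (sg rho : R -> R) :=
  [/\ forall t : R, 0 <= t < T -> forall i,
        is_derive t 1 (fun s => w s i 0) (error_field t (w t) (sg t) (rho t) i 0),
      forall t : R, 0 <= t < T -> is_derive t 1 sg (mismatch_field t (w t) (sg t) (rho t)) &
      forall t : R, 0 <= t < T -> is_derive t 1 rho (rho t * (1 + sg t ^+ 2))].

Hypothesis Mp : forall t, sym_posdef (M t).
Hypothesis sG : forall t l, (Gam t l)^T = Gam t l.
Hypothesis r0 : forall i, 0 <= r 0 i.
Hypothesis mu1 : forall t, 1 <= mu t.
Hypothesis muM : forall t, \tr (M t) <= mu t.
Hypothesis M' : forall (t : R) i j, 0 <= t ->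
  is_derive t 1 (fun s => M s i j) (dirm (Gam t) (v t) i j).
Hypothesis mu' : forall t : R, 0 <= t -> is_derive t 1 mu (dot (dmu t) (v t)).

Let energy (w : R -> 'cV[R]_n) t := 2^-1 * bil (M t) (w t) (w t).
Let energy_derivative (w : R -> 'cV[R]_n) sg rho t :=
  bil (M t) (w t) (error_field t (w t) (sg t) (rho t)) + 2^-1 * bil (dirm (Gam t) (v t)) (w t) (w t).
Let D := 2^-1 * sqn d.

Let D0 : 0 <= D. Proof. by rewrite mulr_ge0 ?invr_ge0// sqn_ge0. Qed.

Let energy_ge0 w t : 0 <= energy w t.
Proof. by rewrite mulr_ge0 ?invr_ge0// posdef_ge0. Qed.

Let energy' T w sg rho t : error_solution T w sg rho -> 0 <= t < T ->
  is_derive t 1 (energy w) (energy_derivative w sg rho t).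
Proof.
move=> [w' _ _] tT; have t0 : 0 <= t by case/andP: tT.
set dw := error_field t (w t) (sg t) (rho t).
have H : is_derive t 1 (energy w) (2^-1 * \sum_i \sum_j
    ((dw i 0 * M t i j + w t i 0 * dirm (Gam t) (v t) i j) * w t j 0 + w t i 0 * M t i j * dw j 0)).
  apply: is_derive_fmull; apply: (@is_derive_fsum _ _ _ _ (fun i _ => _)) => i.
  apply: (@is_derive_fsum _ _ _ _ (fun i _ => _)) => j.
  by apply: is_derive_fmul (w' t tT j); apply: is_derive_fmul (w' t tT i) (M' i j t0).
suff -> : energy_derivative w sg rho t = 2^-1 * \sum_i \sum_j
    ((dw i 0 * M t i j + w t i 0 * dirm (Gam t) (v t) i j) * w t j 0 + w t i 0 * M t i j * dw j 0) by [].
have -> : \sum_i \sum_j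
    ((dw i 0 * M t i j + w t i 0 * dirm (Gam t) (v t) i j) * w t j 0 + w t i 0 * M t i j * dw j 0) =
    bil (M t) dw (w t) + bil (dirm (Gam t) (v t)) (w t) (w t) + bil (M t) (w t) dw.
  rewrite -!big_split; apply: eq_bigr => i _; rewrite -!big_split; apply: eq_bigr => j _ /=.
  by rewrite mulrDl.
by rewrite (bil_sym dw (w t) (Mp t).1) /energy_derivative -/dw; field.
Qed.

Let energy_le1 w sg rho t :
  energy_derivative w sg rho t <= (sg t ^+ 2 + 1 - 2 * rho t ^+ 2) * energy w t + D.
Proof.
have H := energy_rate_le (v t) (w t) d (dmu t) (sg t) (rho t) (Mp t) (sG t) r0 (mu1 t).
apply: le_trans H _; rewrite -addrA lerD2l /D.
have mu0 : 0 < mu t by rewrite (lt_le_trans _ (mu1 t)).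
have h1 : 2^-1 * sqn d / mu t <= 2^-1 * sqn d by rewrite ler_pdivrMr// ler_peMr.
have tau0 : 0 <= tau t by rewrite addr_ge0// posdef_tr_ge0//; exact: posdef_inv.
have : 0 <= al t * (1 + sqn (v t + w t)) * (2^-1 * bil (M t) (w t) (w t)).
  apply: mulr_ge0 (energy_ge0 w t); apply: mulr_ge0; last by rewrite addr_ge0// sqn_ge0.
  apply: mulr_ge0 => //; rewrite !addr_ge0 ?sqn_ge0 ?(ltW mu0) ?sqr_ge0//.
  by apply: sumr_ge0 => l _; apply: sumr_ge0 => i _; apply: sumr_ge0 => j _; exact: sqr_ge0.
lra.
Qed.

Let mismatch_le w sg rho t : 1 <= rho t ->
  sg t * mismatch_field t (w t) (sg t) (rho t) <= - sg t ^+ 2 + energy w t / rho t.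
Proof. by move=> rho1; exact: mismatch_rate_le. Qed.

Lemma error_cvg w sg rho : 1 <= rho 0 -> (forall T, error_solution T w sg rho) ->
  forall i, (M t *m w t) i 0 @[t --> +oo] --> (0 : R).
Proof.
move=> rho0 H i.
have tT (t : R) : 0 <= t -> 0 <= t < t + 1 by move=> ->; rewrite ltrDl ltr01.
have rho' (t : R) : 0 <= t -> is_derive t 1 rho (rho t * (1 + sg t ^+ 2)).
  by move=> /tT; have [_ _] := H (t + 1); apply.
have rho1 (t : R) : 0 <= t -> 1 <= rho t.
  move=> t0; apply: (@scaling_ge1 _ sg rho (t + 1)) => //; last exact: tT.
  by move=> s /andP[s0 _]; exact: rho'.
have F0 : mu t * energy w t @[t --> +oo] --> (0 : R).
  apply: (@cvg_weighted_energy _ (energy w) (energy_derivative w sg rho) sg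
    (fun t => mismatch_field t (w t) (sg t) (rho t)) rho _
    (fun t => dot (dmu t) (v t) * energy w t + mu t * energy_derivative w sg rho t) D) => //.
  - by move=> t t0; rewrite mulr_ge0// (le_trans ler01).
  - by move=> t /tT; exact: energy'.
  - by move=> t t0; apply: is_derive_fmul (mu' t0) (energy' (H _) (tT _ t0)).
  - by move=> t /tT; have [_ + _] := H (t + 1); apply.
  - by move=> t t0; apply: mismatch_le; exact: rho1.
  - move=> t t0; rewrite addrC.
    exact: (weighted_rate_le (v t) (w t) d (dmu t) (sg t) (rho t) (Mp t) (sG t) r0 (mu1 t)).
apply/cvgrPdist_le => e e0.
(* The threshold comes from [(M w)_i ^ 2 <= tr M (w^T M w) <= 2 mu E]. *)
have : \forall t \near +oo, mu t * energy w t <= 2^-1 * e ^+ 2.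
  by apply: (cvgr_le _ F0); rewrite mulr_gt0// ?invr_gt0// exprn_gt0.
apply: filterS => t Ft.
rewrite sub0r normrN -(@ler_pXn2r _ 2)// ?nnegrE ?(ltW e0)// real_normK ?num_real//.
apply: le_trans (sqn_coord _ _) _; apply: le_trans (sqn_mulmx_le _ (Mp t)) _.
have : \tr (M t) * energy w t <= mu t * energy w t by rewrite ler_wpM2r.
rewrite /energy in Ft *; lra.
Qed.

Hypothesis cP : forall i j, continuous (fun t => P t i j).
Hypothesis cG : forall l i j, continuous (fun t => Gam t l i j).
Hypothesis cv : forall i, continuous (fun t => v t i 0).
Hypothesis cdal : forall i, continuous (fun t => dal t i 0).
Hypothesis cal : continuous (fun t => al t).

Lemma error_exists w0 sg0 rho0 : 1 <= rho0 -> exists w sg rho,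
  [/\ w 0 = w0, sg 0 = sg0, rho 0 = rho0 & forall T, error_solution T w sg rho].
Proof.
move=> rho01; have rho00 : 0 <= rho0 := le_trans ler01 rho01.
(* Scalar components of the error system: [inl i] for the entries of [w], [inr true] for [sg],
   [inr false] for [rho]. *)
pose I := ('I_n + bool)%type.
pose W (y : I -> R) : 'cV[R]_n := \col_i y (inl i).
pose F (k : I) t (y : I -> R) : R := match k with
  | inl i => error_field t (W y) (y (inr true)) (y (inr false)) i 0
  | inr true => mismatch_field t (W y) (y (inr true)) (y (inr false))
  | inr false => y (inr false) * (1 + y (inr true) ^+ 2) end.
pose y0 (k : I) : R := match k with inl i => w0 i 0 | inr true => sg0 | inr false => rho0 end.
have ctau : continuous (fun t => tau t).
  move=> t; apply: cvgD; first exact: cst_continuous.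
  by apply: cvg_big => [|i _]; [exact: add_continuous|exact: cP].
have cW : vloclip (fun _ => W).
  by move=> i; apply: eq_loclip (loclip_coord (inl i)) => t y; rewrite mxE.
have cvW : vloclip (fun t y => v t + W y).
  by apply: vloclipD => //; exact: vloclip_time.
have cV : loclip (fun t y => 1 + sqn (v t + W y)).
  by apply: loclipD; [exact: loclip_cst|exact: loclip_sqn].
have cS := @loclip_coord R I (inr true).
have cR := @loclip_coord R I (inr false).
have cg : loclip (fun t y => innovation_gain t (W y) (y (inr true)) (y (inr false))).
  apply: loclipD; last exact: loclipX.
  by apply: loclipD => //; apply: loclipM => //; exact: loclip_time.
have cd : vloclip (fun t y => mismatch_dir t (W y) (y (inr true)) (y (inr false))).
  apply: vloclipD; first by apply: vloclipZ => //; exact: vloclip_time.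
  apply: vloclipZ => //; apply: loclipM => //; apply: loclipM.
    exact: loclip_cst.
  exact: loclip_time.
have cF k : loclip (F k).
  case: k => [i|[]] /=.
  - apply: (_ : vloclip (fun t y => error_field t (W y) (y (inr true)) (y (inr false)))).
    apply: vloclipB; last exact: vloclipZ.
    apply: vloclip_mulmx => //.
    apply: vloclipB; last by apply: vloclip_time => j t; exact: cst_continuous.
    apply: vloclipB; last first.
      by apply: vloclip_mulmx => // j k t; exact: cst_continuous.
    apply: vloclipB; apply: vloclip_coriolis => //.
    exact: vloclip_time.
  - apply: loclipD; last exact: loclip_dot.
    apply: loclipN; apply: loclipM => //.
    apply: loclipD; first exact: loclip_cst.
    apply: loclipM; last exact: loclip_sqn.
    by apply: loclipM => //; exact: loclip_time.
  - apply: loclipM => //; apply: loclipD; last exact: loclipX.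
    exact: loclip_cst.
have sol (T : R) (y : I -> R -> R) :
    (forall t : R, 0 <= t < T -> forall k, is_derive t 1 (y k) (F k t (y ^~ t))) ->
    error_solution T (fun t => W (y ^~ t)) (y (inr true)) (y (inr false)).
  move=> y'; split=> t tT; [move=> i|exact: (y' t tT (inr true))|exact: (y' t tT (inr false))].
  by under eq_fun do rewrite mxE; exact: (y' t tT (inl i)).
pose U := (2^-1 * bil (M 0) w0 w0) / rho0 + 2^-1 * sg0 ^+ 2 + D.
have U0 : 0 <= U.
  apply: addr_ge0 D0; apply: addr_ge0; last by rewrite mulr_ge0 ?sqr_ge0// invr_ge0.
  by rewrite divr_ge0// mulr_ge0 ?invr_ge0// posdef_ge0.
pose B t := rho0 * expR U * expR t.
(* One bound for all components: [rho <= B], [sg^2 <= 2 U], and [|w|^2 <= 2 tau E <= 2 tau U B].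
   Squares are converted by [|x| <= 1 + x^2]. *)
pose b t := 1 + 2 * U + B t + 2 * tau t * (U * B t).
have tau0 t : 0 <= tau t by rewrite addr_ge0// posdef_tr_ge0//; exact: posdef_inv.
have B0 t : 0 <= B t by rewrite !mulr_ge0 ?expR_ge0.
have bound t (y : I -> R) : 0 <= y (inr false) <= B t ->
    2^-1 * bil (M t) (W y) (W y) <= U * y (inr false) -> y (inr true) ^+ 2 <= 2 * U ->
    forall k, `|y k| <= b t.
  move=> /andP[rh0 rhB] Ew sgU.
  have Z0 : 0 <= 2 * tau t * (U * B t) by rewrite !mulr_ge0.
  have sq (x c : R) : x ^+ 2 <= c -> `|x| <= 1 + c.
    move=> xc; rewrite ler_norml; have := sqr_ge0 (x - 1); have := sqr_ge0 (x + 1) => h1 h2.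
    by apply/andP; split; have := sqr_ge0 x; lra.
  case=> [i|[]].
  - have : y (inl i) ^+ 2 <= 2 * tau t * (U * B t).
      have -> : y (inl i) = W y i 0 by rewrite mxE.
      apply: le_trans (sqn_coord _ _) _; apply: le_trans (sqn_le_energy _ (Mp t)) _.
      apply: ler_wpM2l; first by rewrite mulr_ge0.
      by apply: le_trans Ew _; rewrite ler_wpM2l.
    by move=> /sq; rewrite /b; have := B0 t; lra.
  - by have := sq _ _ sgU; rewrite /b; have := B0 t; lra.
  - by rewrite ger0_norm// /b; lra.
have [y [yy0 y']] : exists y : I -> R -> R, (forall k, y k 0 = y0 k) /\
    (forall t : R, 0 <= t -> forall k, is_derive t 1 (y k) (F k t (y ^~ t))).
  apply: (@ode_global_loclip R I (inr true) F y0 b) => //.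
  - have cB : continuous B.
      by move=> t; apply: cvgM; [exact: cst_continuous|exact: continuous_expR].
    move=> t; apply: cvgD; first by apply: cvgD; [exact: cst_continuous|exact: cB].
    apply: cvgM; first by apply: cvgM; [exact: cst_continuous|exact: ctau].
    by apply: cvgM; [exact: cst_continuous|exact: cB].
  - have Wy0 : W y0 = w0 by apply/colP => i; rewrite mxE.
    apply: bound => /=.
    + rewrite rho00/= /B expR0 mulr1 ler_peMr//.
      by rewrite -[leLHS]expR0 ler_expR.
    + rewrite Wy0 -ler_pdivrMr ?(lt_le_trans ltr01)// /U -addrA lerDl addr_ge0//.
      by rewrite mulr_ge0 ?sqr_ge0// invr_ge0.
    + rewrite /U; have : 0 <= (2^-1 * bil (M 0) w0 w0) / rho0.
        by rewrite divr_ge0// mulr_ge0 ?invr_ge0// posdef_ge0.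
      by have := D0; lra.
  - move=> T y T0 yy0 /sol es t tT.
    have rr : 1 <= y (inr false) 0 by rewrite yy0.
    have [_ sg' rho'] := es.
    have Wy0 : W (y ^~ 0) = w0 by apply/colP => i; rewrite mxE yy0.
    have EU : energy (fun t => W (y ^~ t)) 0 / y (inr false) 0 + 2^-1 * y (inr true) 0 ^+ 2 + D = U.
      by rewrite /U /energy Wy0 !yy0.
    have E0 s : 0 <= s < T -> 0 <= energy (fun t => W (y ^~ t)) s by move=> _; exact: energy_ge0.
    have E' s := @energy' _ _ _ _ s es.
    have El s (_ : 0 <= s < T) := energy_le1 (fun t => W (y ^~ t)) (y (inr true)) (y (inr false)) s.
    have rho1 := @scaling_ge1 _ _ _ _ rr rho'.
    have sl s (sT : 0 <= s < T) :=
      @mismatch_le (fun t => W (y ^~ t)) (y (inr true)) (y (inr false)) s (rho1 s sT).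
    apply: bound.
    + rewrite (le_trans ler01 (rho1 t tT))/=.
      have := unscaled_le D0 rr E0 E' sg' rho' El sl tT.
      by rewrite EU expRN ler_pdivrMr ?expR_gt0// yy0.
    + by have := energy_le D0 rr E0 E' sg' rho' El sl tT; rewrite EU.
    + by have := gain_mismatch_le D0 rr E0 E' sg' rho' El sl tT; rewrite EU.
exists (fun t => W (y ^~ t)), (y (inr true)), (y (inr false)); split; rewrite ?yy0//.
  by apply/colP => i; rewrite mxE yy0.
by move=> T; apply: sol => t /andP[t0 _]; exact: y'.
Qed.

End error_system.

(** * Velocity dynamics *)

Section gradients.
Context {R : realType}.

Lemma derive_grad n (f : 'cV[R]_n -> R) (x w : 'cV[R]_n) : differentiable f x ->
  'D_w f x = dot (grad f x) w.
Proof.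
move=> df; rewrite deriveE// {1}(matrix_sum_delta w) linear_sum /dot; apply: eq_bigr => i _.
rewrite linear_sum big_ord1 linearZ /= mxE deriveE// /GRing.scale /=.
by rewrite mulrC.
Qed.

Lemma is_derive_comp_grad n (f : 'cV[R]_n -> R) (x : R -> 'cV[R]_n) (t : R) dx :
  differentiable f (x t) -> is_derive t 1 x dx ->
  is_derive t 1 (fun s => f (x s)) (dot (grad f (x t)) dx).
Proof.
move=> df x'; have dx' : differentiable x t by apply/derivable1_diffP; case: x'.
have dfx : differentiable (f \o x) t by exact: differentiable_comp.
apply: DeriveDef; first exact: diff_derivable.
rewrite (deriveE _ dfx) diff_comp//= -derive_grad// (deriveE _ df).
by rewrite -(deriveE _ dx'); case: x' => _ ->.
Qed.

Lemma is_derive_entry m n (x : R -> 'M[R]_(m, n)) (t : R) dx i j :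
  is_derive t 1 x dx -> is_derive t 1 (fun s => x s i j) (dx i j).
Proof.
move=> [x' <-]; have /derivable_mxP/(_ i j) xij := x'.
by rewrite derive_mx// mxE; exact: derivableP.
Qed.

Lemma derive_invmx (V : normedModType R) n (A B : V -> 'M[R]_n) (x w : V) :
  (forall y, A y *m B y = 1%:M) ->
  (forall i j, differentiable (fun y => A y i j) x) ->
  (forall i j, differentiable (fun y => B y i j) x) ->
  \matrix_(i, j) 'D_w (fun y => B y i j) x =
    - (B x *m (\matrix_(i, j) 'D_w (fun y => A y i j) x) *m B x).
Proof.
move=> AB dA dB; set dBx := \matrix_(i, j) _; set dAx := \matrix_(i, j) _.
have BA : B x *m A x = 1%:M by apply: mulmx1C.
(* This is the product rule for the constant [A *m B]; multiplying by [B x] on the left isolates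
   [dBx]. *)
suff H : dAx *m B x + A x *m dBx = 0.
  have : B x *m (dAx *m B x + A x *m dBx) = 0 by rewrite H mulmx0.
  rewrite mulmxDr !mulmxA BA mul1mx addrC => /eqP; rewrite addr_eq0 => /eqP ->.
  by [].
apply/matrixP => i j; rewrite !mxE -big_split /=.
have : 'D_w (fun y => (A y *m B y) i j) x = 0.
  rewrite (_ : (fun y => _) = cst ((i == j)%:R : R)); first exact: derive_cst.
  by apply/funext => y; rewrite AB mxE.
have dAB k : derivable (fun y => A y i k * B y k j) x w.
  by apply: diff_derivable; apply: differentiableM; [exact: dA|exact: dB].
rewrite (_ : (fun y => _) = \sum_k (fun y => A y i k * B y k j)); last first.
  by apply/funext => y; rewrite mxE fct_sumE.
rewrite derive_sum// => H; rewrite -[RHS]H; apply: eq_bigr => k _.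
rewrite deriveM; [|exact: diff_derivable|exact: diff_derivable].
by rewrite !mxE /GRing.scale /= [RHS]addrC [B x k j * _]mulrC.
Qed.

Lemma derive_bil n (A : 'M[R]_n) (p w : 'cV[R]_n) :
  is_derive p w (fun z => bil A z z) (bil A w p + bil A p w).
Proof.
have dc i : is_derive p w (fun z : 'cV[R]_n => z i 0) (w i 0).
  have did : derivable (fun z : 'cV[R]_n => z) p w by exact: derivable_id.
  have /derivable_mxP/(_ i 0) di := did.
  have := derive_mx did; rewrite derive_id => /matrixP/(_ i 0); rewrite mxE => ->.
  exact: derivableP.
have dij i j : is_derive p w (fun z : 'cV[R]_n => z i 0 * A i j * z j 0)
    (w i 0 * A i j * p j 0 + p i 0 * A i j * w j 0).
  have h := is_deriveZ (A i j) (is_deriveM (dc i) (dc j)).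
  rewrite (_ : (fun z : 'cV[R]_n => _) = A i j \*: ((fun z : 'cV[R]_n => z i 0) * (fun z => z j 0))).
    by apply: is_derive_eq h _; rewrite /GRing.scale /=; ring.
  by apply/funext => z; transitivity (A i j * (z i 0 * z j 0)); first by ring.
have -> : bil A w p + bil A p w =
    \sum_i \sum_j (w i 0 * A i j * p j 0 + p i 0 * A i j * w j 0).
  by rewrite -big_split; apply: eq_bigr => i _; rewrite -big_split.
rewrite (_ : (fun z => _) = \sum_i \sum_j (fun z : 'cV[R]_n => z i 0 * A i j * z j 0)).
  by apply: is_derive_sum => i; exact: is_derive_sum.
by apply/funext => z; rewrite fct_sumE; apply: eq_bigr => i _; rewrite fct_sumE.
Qed.

End gradients.

(** * Gradients of the Hamiltonian *)

Section mechanics.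
Context {R : realType} {n : nat}.
Variables (M : 'cV[R]_n -> 'M[R]_n) (V : 'cV[R]_n -> R).
Hypothesis M_smooth : smooth M.
Hypothesis V_smooth : smooth V.
Hypothesis Mp : forall q, sym_posdef (M q).

Definition inertia_derivative (q : 'cV[R]_n) (l : 'I_n) : 'M[R]_n :=
  \matrix_(i, j) grad (fun z => M z i j) q l 0.

Local Notation P q := (invmx (M q)).
Local Notation Gam := inertia_derivative.

Lemma smooth_M_entry i j : smooth (fun q => M q i j).
Proof. exact: smooth_entry. Qed.

Lemma smooth_P_entry i j : smooth (fun q => P q i j).
Proof. by apply: smooth_invmx => // q; exact: posdef_unit. Qed.

Lemma smooth_inertia_derivative l i j : smooth (fun q => Gam q l i j).
Proof.
apply: (eq_smooth _ (smooth_derive (delta_mx l 0) (smooth_M_entry i j))) => q.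
by rewrite !mxE.
Qed.

Lemma inertia_derivative_sym q l : (Gam q l)^T = Gam q l.
Proof.
apply/matrixP => i j; rewrite !mxE; congr ('D_ _ _ _); apply/funext => z.
by rewrite -{1}(Mp z).1 mxE.
Qed.

Lemma dirm_inertia_derivative q x i j :
  dirm (Gam q) x i j = dot (grad (fun z => M z i j) q) x.
Proof. by rewrite /dirm summxE; apply: eq_bigr => l _; rewrite !mxE mulrC. Qed.

Lemma grad_invmx q l :
  \matrix_(i, j) grad (fun z => P z i j) q l 0 = - (P q *m Gam q l *m P q).
Proof.
have H := @derive_invmx R 'cV[R]_n n M (fun z => P z) q (delta_mx l 0)
  (fun z => posdef_mulV (Mp z))
  (fun i j => smooth_differentiable q (smooth_M_entry i j))
  (fun i j => smooth_differentiable q (smooth_P_entry i j)).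
have -> : Gam q l = \matrix_(i, j) 'D_(delta_mx l 0) (fun z => M z i j) q.
  by apply/matrixP => i j; rewrite !mxE.
by rewrite -H; apply/matrixP => i j; rewrite !mxE.
Qed.

Lemma bil_grad q (p : 'cV[R]_n) l : is_derive q (delta_mx l 0)
  (fun z => bil (P z) p p) (- bil (Gam q l) (P q *m p) (P q *m p)).
Proof.
have dP i j : differentiable (fun z => P z i j) q.
  exact: smooth_differentiable (smooth_P_entry i j).
have db : differentiable (fun z => bil (P z) p p) q.
  apply: smooth_differentiable; apply: smooth_sum => i; apply: smooth_sum => j.
  apply: smoothM; last exact: smooth_cst.
  by apply: smoothM; [exact: smooth_cst|exact: smooth_P_entry].
apply: DeriveDef; first exact: diff_derivable.
have -> : - bil (Gam q l) (P q *m p) (P q *m p) =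
    bil (\matrix_(i, j) grad (fun z => P z i j) q l 0) p p.
  rewrite grad_invmx !bilE trmx_mul invmx_sym ?(Mp q).1//.
  by rewrite mulmxN mulNmx [RHS]mxE !mulmxA.
rewrite /bil (_ : (fun z => _) = \sum_i \sum_j (fun z => p i 0 * P z i j * p j 0)); last first.
  by apply/funext => z; rewrite fct_sumE; apply: eq_bigr => i _; rewrite fct_sumE.
have dij i j : derivable (fun z => p i 0 * P z i j * p j 0) q (delta_mx l 0).
  apply: diff_derivable; apply: smooth_differentiable.
  apply: smoothM; last exact: smooth_cst.
  by apply: smoothM; [exact: smooth_cst|exact: smooth_P_entry].
rewrite derive_sum => [|i]; last exact: derivable_sum.
apply: eq_bigr => i _; rewrite derive_sum//; apply: eq_bigr => j _; rewrite !mxE.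
have dPij : derivable (fun z => P z i j) q (delta_mx l 0) by exact: diff_derivable.
have -> : (fun z => p i 0 * P z i j * p j 0) = (p i 0 * p j 0) \*: (fun z => P z i j).
  by apply/funext => z; rewrite /= /GRing.scale /= mulrAC.
by rewrite deriveZ// /GRing.scale /= mulrAC.
Qed.

Lemma grad_hamiltonian_q q p :
  grad (fun z => hamiltonian M V z p) q =
  \col_l (- 2^-1 * bil (Gam q l) (P q *m p) (P q *m p)) + grad V q.
Proof.
apply/colP => l; rewrite !mxE.
have dV : derivable V q (delta_mx l 0).
  by apply: diff_derivable; exact: smooth_differentiable.
have [db dbE] := bil_grad q p l.
rewrite (_ : (fun z => _) = (2^-1 \*: (fun z => bil (P z) p p)) + V); last first.
  by apply/funext => z; rewrite /hamiltonian -bilE.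
by rewrite deriveD// ?deriveZ ?dbE//; [rewrite /GRing.scale /= mulrN mulNr|exact: derivableZ].
Qed.

Lemma grad_hamiltonian_p q p : grad (fun z => hamiltonian M V q z) p = P q *m p.
Proof.
have sP := invmx_sym (Mp q).1.
apply/colP => l; rewrite mxE.
have [db dbE] := derive_bil (P q) p (delta_mx l 0).
rewrite (_ : (fun z => _) = (2^-1 \*: (fun z => bil (P q) z z)) + cst (V q)); last first.
  by apply/funext => z; rewrite /hamiltonian -bilE.
rewrite deriveD ?derive_cst ?deriveZ ?dbE//; last exact: derivableZ.
rewrite (bil_sym p _ sP) addr0 /GRing.scale /=.
have -> : bil (P q) (delta_mx l 0) p = (P q *m p) l 0.
  by rewrite bilE trmx_delta -mulmxA -rowE mxE.
by field.
Qed.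

End mechanics.

(** * The equation of motion in velocity coordinates *)

Section velocity.
Context {R : realType} {n : nat}.
Variables (M : 'cV[R]_n -> 'M[R]_n) (V : 'cV[R]_n -> R) (r : 'rV[R]_n).
Hypothesis M_smooth : smooth M.
Hypothesis V_smooth : smooth V.
Hypothesis Mp : forall q, sym_posdef (M q).
Local Notation P q := (invmx (M q)).
Local Notation Gam := (inertia_derivative M).

Definition acceleration (q v : 'cV[R]_n) (f : 'cV[R]_n) : 'cV[R]_n :=
  P q *m (f - coriolis (Gam q) v - grad V q - diag_mx r *m v).

Lemma is_derive_inertia (q : R -> 'cV[R]_n) (t : R) v i j : is_derive t 1 q v ->
  is_derive t 1 (fun s => M (q s) i j) (dirm (Gam (q t)) v i j).
Proof.
move=> q'; rewrite dirm_inertia_derivative.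
by apply: is_derive_comp_grad => //; apply: smooth_differentiable; exact: smooth_M_entry.
Qed.

Lemma is_derive_inv_inertia (q : R -> 'cV[R]_n) (t : R) v i j : is_derive t 1 q v ->
  is_derive t 1 (fun s => P (q s) i j) (- (P (q t) *m dirm (Gam (q t)) v *m P (q t)) i j).
Proof.
move=> q'; have -> : - (P (q t) *m dirm (Gam (q t)) v *m P (q t)) i j =
    dot (grad (fun z => P z i j) (q t)) v.
  rewrite /dirm mulmx_sumr mulmx_suml summxE -sumrN; apply: eq_bigr => l _.
  have := grad_invmx M_smooth Mp (q t) l => /matrixP/(_ i j).
  rewrite mxE => ->; rewrite -scalemxAr -scalemxAl [in LHS]mxE [in RHS]mxE.
  by rewrite mulNr mulrC.
apply: is_derive_comp_grad => //; apply: smooth_differentiable; exact: smooth_P_entry.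
Qed.

(** With [v = M^-1 p], the derivative of [M^-1] contributes [- M^-1 M' v], so
    [v' = M^-1 (p' - M' v)]. The term [M' v] and the kinetic part of the gradient in [q] combine
    into [coriolis]. *)
Lemma is_derive_velocity (q p : R -> 'cV[R]_n) (t : R) (f : 'cV[R]_n) :
  is_derive t 1 q (grad (fun z => hamiltonian M V (q t) z) (p t)) ->
  is_derive t 1 p (- grad (fun z => hamiltonian M V z (p t)) (q t)
     - diag_mx r *m grad (fun z => hamiltonian M V (q t) z) (p t) + f) ->
  forall i, is_derive t 1 (fun s => (P (q s) *m p s) i 0)
    (acceleration (q t) (P (q t) *m p t) f i 0).
Proof.
rewrite grad_hamiltonian_p// grad_hamiltonian_q// => q' p' i.
set v := P (q t) *m p t in q' p' *; set p1 := (X in is_derive t 1 p X) in p'.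
have H : is_derive t 1 (fun s => \sum_j P (q s) i j * p s j 0)
    (\sum_j (- (P (q t) *m dirm (Gam (q t)) v *m P (q t)) i j * p t j 0 + P (q t) i j * p1 j 0)).
  apply: (@is_derive_fsum _ _ _ _ (fun j _ => _)) => j.
  by apply: is_derive_fmul (is_derive_inv_inertia i j q') (is_derive_entry j 0 p').
rewrite (_ : (fun s => _) = (fun s => \sum_j P (q s) i j * p s j 0)); last first.
  by apply/funext => s; rewrite mxE.
suff -> : acceleration (q t) v f i 0 =
    \sum_j (- (P (q t) *m dirm (Gam (q t)) v *m P (q t)) i j * p t j 0 + P (q t) i j * p1 j 0) by [].
rewrite big_split /=.
have -> : \sum_j - (P (q t) *m dirm (Gam (q t)) v *m P (q t)) i j * p t j 0 =
    - (P (q t) *m (dirm (Gam (q t)) v *m v)) i 0.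
  rewrite !mulmxA -(mulmxA _ (P (q t)) (p t)) -/v -mulmxA mulmxA [in RHS]mxE -sumrN.
  rewrite /v; transitivity (- (P (q t) *m dirm (Gam (q t)) v *m P (q t) *m p t) i 0).
    by rewrite mxE -sumrN; apply: eq_bigr => j _; rewrite mulNr.
  by rewrite -[in LHS]mulmxA -/v mxE -sumrN.
have -> : \sum_j P (q t) i j * p1 j 0 = (P (q t) *m p1) i 0 by rewrite mxE.
rewrite addrC; have -> : (P (q t) *m p1) i 0 - (P (q t) *m (dirm (Gam (q t)) v *m v)) i 0 =
   (P (q t) *m (p1 - dirm (Gam (q t)) v *m v)) i 0 by rewrite mulmxBr !mxE.
congr ((P (q t) *m _) i 0); apply/colP => k; rewrite /p1 /coriolis !mxE.
by ring.
Qed.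

End velocity.

(** * The observer *)

Section smooth_vectors.
Context {R : realType} {U : normedModType R}.

Definition vsmooth n (f : U -> 'cV[R]_n) := forall i, smooth (fun x => f x i 0).

Lemma vsmoothD n (f g : U -> 'cV[R]_n) : vsmooth f -> vsmooth g -> vsmooth (fun x => f x + g x).
Proof. by move=> sf sg i; apply: eq_smooth (smoothD (sf i) (sg i)) => x; rewrite mxE. Qed.

Lemma vsmoothB n (f g : U -> 'cV[R]_n) : vsmooth f -> vsmooth g -> vsmooth (fun x => f x - g x).
Proof. by move=> sf sg i; apply: eq_smooth (smoothB (sf i) (sg i)) => x; rewrite !mxE. Qed.

Lemma vsmoothZ n (s : U -> R) (f : U -> 'cV[R]_n) : smooth s -> vsmooth f ->
  vsmooth (fun x => s x *: f x).
Proof. by move=> ss sf i; apply: eq_smooth (smoothM ss (sf i)) => x; rewrite mxE. Qed.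

Lemma vsmooth_mulmx k n (A : U -> 'M[R]_(k, n)) (f : U -> 'cV[R]_n) :
  (forall i j, smooth (fun x => A x i j)) -> vsmooth f -> vsmooth (fun x => A x *m f x).
Proof.
move=> sA sf i; apply: (@eq_smooth _ _ _ (fun x => \sum_j A x i j * f x j 0)) => [x|].
  by rewrite mxE.
by apply: smooth_sum => j; apply: smoothM.
Qed.

Lemma smooth_dot n (f g : U -> 'cV[R]_n) : vsmooth f -> vsmooth g ->
  smooth (fun x => dot (f x) (g x)).
Proof. by move=> sf sg; apply: smooth_sum => i; exact: smoothM. Qed.

Lemma smooth_sqn n (f : U -> 'cV[R]_n) : vsmooth f -> smooth (fun x => sqn (f x)).
Proof. by move=> sf; apply: smooth_sum => i; exact: smoothX. Qed.

Lemma vsmooth_coriolis n (Gam : U -> 'I_n -> 'M[R]_n) (f : U -> 'cV[R]_n) :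
  (forall l i j, smooth (fun x => Gam x l i j)) -> vsmooth f ->
  vsmooth (fun x => coriolis (Gam x) (f x)).
Proof.
move=> sG sf i; apply: (@eq_smooth _ _ _ (fun x =>
    \sum_j (\sum_l f x l 0 * Gam x l i j) * f x j 0 -
    2^-1 * \sum_k \sum_j f x k 0 * Gam x i k j * f x j 0)) => [x|].
  rewrite /coriolis !mxE; congr (_ - _); apply: eq_bigr => j _; rewrite summxE.
  by congr (_ * _); apply: eq_bigr => l _; rewrite mxE.
apply: smoothB.
  apply: smooth_sum => j; apply: smoothM => //; apply: smooth_sum => l.
  by apply: smoothM.
apply: smoothM; first exact: smooth_cst.
by apply: smooth_sum => k; apply: smooth_sum => j; apply: smoothM => //; apply: smoothM.
Qed.

Lemma vsmooth_grad n (f : 'cV[R]_n -> R) : smooth f ->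
  forall i, smooth (fun x => grad f x i 0).
Proof.
by move=> sf i; apply: eq_smooth (smooth_derive (delta_mx i 0) sf) => x; rewrite mxE.
Qed.

End smooth_vectors.

(** * The observer vector field and its smoothness *)

Section observer.
Context {R : realType} {n m N : nat}.
Variables (iota : 'I_n -> 'I_N) (kap : 'I_N).
Variables (M : 'cV[R]_n -> 'M[R]_n) (V : 'cV[R]_n -> R) (G : 'cV[R]_n -> 'M[R]_(n, m)).
Variable r : 'rV[R]_n.
Hypothesis M_smooth : smooth M.
Hypothesis V_smooth : smooth V.
Hypothesis G_smooth : smooth G.
Hypothesis Mp : forall q, sym_posdef (M q).

Local Notation state := ('cV[R]_N * R)%type.
Local Notation P q := (invmx (M q)).
Local Notation Gam := (inertia_derivative M).

Definition inertia_trace (q : 'cV[R]_n) : R := 1 + \tr (M q).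
Local Notation mu := inertia_trace.

Definition damping_weight (q : 'cV[R]_n) : R := gain_weight (P q) (Gam q) (mu q) (grad mu q).
Local Notation al := damping_weight.

(* The entries [iota i] of the state hold the offset [xi], the entry [kap] holds
   the gain state [k], and the last component is [rho - 1]; the remaining entries
   are idle. *)
Definition obs_scaling (X : state) : R := 1 + X.2.
Definition obs_gain (X : state) : R := X.1 kap 0 + obs_scaling X ^+ 2.
Definition obs_offset (X : state) : 'cV[R]_n := \col_i X.1 (iota i) 0.
Definition obs_velocity (X : state) q : 'cV[R]_n := obs_offset X + obs_gain X *: q.
Definition obs_mismatch (X : state) q : R :=
  X.1 kap 0 - al q * (1 + sqn (obs_velocity X q)).
Definition obs_dir (X : state) q : 'cV[R]_n :=
  (1 + sqn (obs_velocity X q)) *: grad al q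
  + (2 * al q * obs_gain X) *: obs_velocity X q.
Definition obs_accel (X : state) q (u : 'cV[R]_m) : 'cV[R]_n :=
  acceleration M V r q (obs_velocity X q) (G q *m u).

(** The first two terms are the derivative of the target [al q (1 + |vh|^2)] with the unknown [v]
    replaced by [vh] and the innovation in [vh'] omitted. The last is the feedback on the gap,
    strong enough for [mismatch_rate_le]. *)
Definition gain_rate (X : state) q u : R :=
  (1 + sqn (obs_velocity X q)) * dot (grad al q) (obs_velocity X q)
  + 2 * al q * dot (obs_velocity X q) (obs_accel X q u)
  - (1 + inertia_bound (P q) * obs_scaling X * sqn (obs_dir X q)) * obs_mismatch X q.
Definition scaling_rate (X : state) q : R := obs_scaling X * (1 + obs_mismatch X q ^+ 2).
Definition total_gain_rate (X : state) q u : R :=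
  gain_rate X q u + 2 * obs_scaling X * scaling_rate X q.
(** Solves [xi' + g' q + g v = obs_accel - g (vh - v)] for [xi']: the unmeasured [v] drops out, and
    [vh = xi + g q] obeys the copied dynamics with innovation [- g w]. *)
Definition offset_rate (X : state) q u : 'cV[R]_n :=
  obs_accel X q u - total_gain_rate X q u *: q - obs_gain X *: obs_velocity X q.

(** A combination of constant vectors with scalar coefficients, so smoothness and derivatives are
    obtained summand by summand. *)
Definition assemble (x : 'cV[R]_n) (k s : R) : state :=
  \sum_i x i 0 *: (delta_mx (iota i) 0, 0) + k *: (delta_mx kap 0, 0) + s *: (0, 1).

Definition observer (z : state * 'cV[R]_n * 'cV[R]_m) : state :=
  assemble (offset_rate z.1.1 z.1.2 z.2) (gain_rate z.1.1 z.1.2 z.2) (scaling_rate z.1.1 z.1.2).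

Definition momentum_estimate (z : state * 'cV[R]_n) : 'cV[R]_n :=
  M z.2 *m obs_velocity z.1 z.2.

Lemma smooth_inertia_trace : smooth mu.
Proof.
apply: smoothD; first exact: smooth_cst.
by apply: smooth_sum => i; exact: smooth_entry.
Qed.

Lemma smooth_inertia_bound : smooth (fun q => inertia_bound (P q)).
Proof.
apply: smoothD; first exact: smooth_cst.
by apply: smooth_sum => i; exact: smooth_P_entry.
Qed.

Lemma smooth_damping_weight : smooth al.
Proof.
apply: smoothM; first exact: smooth_inertia_bound.
apply: smoothD; last by apply: smooth_sqn => i; apply: vsmooth_grad; exact: smooth_inertia_trace.
apply: smoothD; last exact: smooth_cst.
apply: smoothD; last exact: smooth_inertia_trace.
apply: smoothD; first exact: smooth_cst.
apply: smooth_sum => l; apply: smooth_sum => i; apply: smooth_sum => j.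
by apply: smoothX; exact: smooth_inertia_derivative.
Qed.

Section smoothness.
Variable U : normedModType R.
Variables (X : U -> state) (q : {linear U -> 'cV[R]_n}) (u : U -> 'cV[R]_m).
Hypothesis X_smooth : smooth X.
Hypothesis q_cont : continuous q.
Hypothesis u_smooth : smooth u.

Let sq (f : 'cV[R]_n -> R) : smooth f -> smooth (fun z => f (q z)).
Proof. exact: smooth_comp_linear. Qed.

Let s_X1 j : smooth (fun z => (X z).1 j 0).
Proof. by apply: smooth_entry; exact: smooth_fst. Qed.

Let s_scaling : smooth (fun z => obs_scaling (X z)).
Proof. by apply: smoothD; [exact: smooth_cst|exact: smooth_snd]. Qed.

Let s_gain : smooth (fun z => obs_gain (X z)).
Proof. by apply: smoothD => //; exact: smoothX. Qed.

Let s_q : vsmooth q.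
Proof.
move=> i; apply: (sq (f := fun x => x i 0)); apply: smooth_entry => k; exact: Ck_id.
Qed.

Let s_velocity : vsmooth (fun z => obs_velocity (X z) (q z)).
Proof.
apply: vsmoothD; last exact: vsmoothZ.
by move=> i; apply: eq_smooth (s_X1 (iota i)) => z; rewrite mxE.
Qed.

Let s_1sqn : smooth (fun z => 1 + sqn (obs_velocity (X z) (q z))).
Proof. by apply: smoothD; [exact: smooth_cst|exact: smooth_sqn]. Qed.

Let s_al : smooth (fun z => al (q z)).
Proof. by apply: sq; exact: smooth_damping_weight. Qed.

Let s_2al : smooth (fun z => 2 * al (q z)).
Proof. by apply: smoothM => //; exact: smooth_cst. Qed.

Let s_dal : vsmooth (fun z => grad al (q z)).
Proof.
move=> i; apply: (sq (f := fun x => grad al x i 0)); apply: vsmooth_grad.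
exact: smooth_damping_weight.
Qed.

Let s_mismatch : smooth (fun z => obs_mismatch (X z) (q z)).
Proof. by apply: smoothB => //; exact: smoothM. Qed.

Let s_dir : vsmooth (fun z => obs_dir (X z) (q z)).
Proof. by apply: vsmoothD; apply: vsmoothZ => //; exact: smoothM. Qed.

Let s_P i j : smooth (fun z => P (q z) i j).
Proof. by apply: (sq (f := fun x => P x i j)); exact: smooth_P_entry. Qed.

Let s_accel : vsmooth (fun z => obs_accel (X z) (q z) (u z)).
Proof.
apply: vsmooth_mulmx => //; apply: vsmoothB; last first.
  by apply: vsmooth_mulmx => // i j; exact: smooth_cst.
apply: vsmoothB; last first.
  by move=> i; apply: (sq (f := fun x => grad V x i 0)); exact: vsmooth_grad.
apply: vsmoothB; last first.
  apply: vsmooth_coriolis => // l i j.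
  by apply: (sq (f := fun x => Gam x l i j)); exact: smooth_inertia_derivative.
apply: vsmooth_mulmx => [i j|i]; last exact: smooth_entry.
by apply: (sq (f := fun x => G x i j)); exact: smooth_entry.
Qed.

Let s_gain_rate : smooth (fun z => gain_rate (X z) (q z) (u z)).
Proof.
apply: smoothB; first apply: smoothD.
- by apply: smoothM => //; exact: smooth_dot.
- by apply: smoothM => //; exact: smooth_dot.
- apply: smoothM => //; apply: smoothD; first exact: smooth_cst.
  apply: smoothM; last exact: smooth_sqn.
  by apply: smoothM => //; apply: (sq (f := fun x => inertia_bound (P x))); exact: smooth_inertia_bound.
Qed.

Let s_scaling_rate : smooth (fun z => scaling_rate (X z) (q z)).
Proof.
apply: smoothM => //; apply: smoothD; first exact: smooth_cst.
exact: smoothX.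
Qed.

Let s_offset_rate : vsmooth (fun z => offset_rate (X z) (q z) (u z)).
Proof.
apply: vsmoothB; last exact: vsmoothZ.
apply: vsmoothB => //; apply: vsmoothZ => //; apply: smoothD => //.
apply: smoothM => //; apply: smoothM => //; exact: smooth_cst.
Qed.

Lemma smooth_observer_comp : smooth (fun z => observer (X z, q z, u z)).
Proof.
apply: smoothD; last exact: smoothZl.
apply: smoothD; last exact: smoothZl.
by apply: smooth_sum => i; exact: smoothZl.
Qed.

Lemma smooth_estimate_comp : smooth (fun z => momentum_estimate (X z, q z)).
Proof.
apply: smooth_mx => i j; rewrite (ord1 j).
apply: vsmooth_mulmx => // k l; apply: (sq (f := fun x => M x k l)).
exact: smooth_entry.
Qed.

End smoothness.

Lemma smooth_observer : smooth observer.
Proof.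
have s_id : smooth (fun z : state * 'cV[R]_n * 'cV[R]_m => z) by move=> k; exact: Ck_id.
apply: (@eq_smooth _ _ _ (fun z : state * 'cV[R]_n * 'cV[R]_m => observer (z.1.1, (snd \o fst) z, z.2))).
  by move=> [[X q] u].
apply: smooth_observer_comp.
- by apply: smooth_fst; exact: smooth_fst.
- move=> z; apply: (@continuous_comp _ _ _ fst snd); [exact: cvg_fst|exact: cvg_snd].
- exact: smooth_snd.
Qed.

Lemma smooth_estimate : smooth momentum_estimate.
Proof.
have s_id : smooth (fun z : state * 'cV[R]_n => z) by move=> k; exact: Ck_id.
apply: (@eq_smooth _ _ _ (fun z : state * 'cV[R]_n => momentum_estimate (z.1, snd z))).
  by move=> [X q].
apply: smooth_estimate_comp; first exact: smooth_fst.
by move=> z; exact: cvg_snd.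
Qed.

End observer.

(** * Observer trajectories and the error system *)

Section derivative_transport.
Context {R : realType}.

Lemma is_derive_fscale (W : normedModType R) (f : R -> R) (t df : R) (c : W) :
  is_derive t 1 f df -> is_derive t 1 (fun s => f s *: c) (df *: c).
Proof.
move=> /is_deriveP f'; apply/is_deriveP.
under eq_fun do rewrite -scalerBl scalerA.
exact: cvgZr_tmp.
Qed.

Lemma is_derive_vadd (W : normedModType R) (f g : R -> W) (t : R) df dg :
  is_derive t 1 f df -> is_derive t 1 g dg -> is_derive t 1 (fun s => f s + g s) (df + dg).
Proof. by move=> f' g'; exact: is_deriveD. Qed.

Lemma is_derive_vsum (W : normedModType R) (I : finType) (f : I -> R -> W) (t : R) df :
  (forall i, is_derive t 1 (f i) (df i)) ->
  is_derive t 1 (fun s => \sum_i f i s) (\sum_i df i).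
Proof.
move=> f'; elim: (index_enum I) => [|i r IH].
  rewrite big_nil (_ : (fun s => _) = cst 0); first exact: is_derive_cst.
  by apply/funext => s; rewrite big_nil.
rewrite big_cons (_ : (fun s => _) = (fun s => f i s + \sum_(i <- r) f i s)).
  exact: is_derive_vadd.
by apply/funext => s; rewrite big_cons.
Qed.

Lemma is_derive_linear (W W' : normedModType R) (L : {linear W -> W'}) (x : R -> W) (t : R) dx :
  continuous L -> is_derive t 1 x dx -> is_derive t 1 (fun s => L (x s)) (L dx).
Proof.
move=> cL x'; have dx' : differentiable x t by apply/derivable1_diffP; case: x'.
have dLx : differentiable (L \o x) t.
  by apply: differentiable_comp => //; exact: linear_differentiable.
apply: DeriveDef; first exact: diff_derivable.
rewrite (deriveE _ dLx) diff_comp//=; last exact: linear_differentiable.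
by rewrite diff_lin// -(deriveE _ dx'); case: x' => _ ->.
Qed.

Lemma is_derive_sqn n (x dx : R -> 'cV[R]_n) (t : R) :
  (forall i, is_derive t 1 (fun s => x s i 0) (dx t i 0)) ->
  is_derive t 1 (fun s => sqn (x s)) (2 * dot (x t) (dx t)).
Proof.
move=> x'; rewrite /dot big_distrr /=.
apply: (@is_derive_fsum _ _ _ _ (fun i t => 2 * (x t i 0 * dx t i 0))) => i.
by rewrite mulrA; exact: is_derive_fsqr.
Qed.

End derivative_transport.

Section observer_dynamics.
Context {R : realType} {n m N : nat}.
Variables (iota : 'I_n -> 'I_N) (kap : 'I_N).
Hypothesis iota_inj : injective iota.
Hypothesis kap_iota : forall i, kap != iota i.
Variables (M : 'cV[R]_n -> 'M[R]_n) (V : 'cV[R]_n -> R) (G : 'cV[R]_n -> 'M[R]_(n, m)).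
Variable r : 'rV[R]_n.
Hypothesis M_smooth : smooth M.
Hypothesis V_smooth : smooth V.
Hypothesis Mp : forall q, sym_posdef (M q).

Local Notation state := ('cV[R]_N * R)%type.
Local Notation P q := (invmx (M q)).
Local Notation Gam := (inertia_derivative M).
Local Notation mu := (inertia_trace M).
Local Notation al := (damping_weight M).
Local Notation obs := (observer iota kap M V G r).
Local Notation vh := (obs_velocity iota kap).
Local Notation gain := (obs_gain kap).
Local Notation mismatch := (obs_mismatch iota kap M).
Local Notation accel := (obs_accel iota kap M V G r).

Lemma assemble_iota (x : 'cV[R]_n) k s i : (assemble iota kap x k s).1 (iota i) 0 = x i 0.
Proof.
rewrite /assemble /= raddf_sum /= !mxE summxE (bigD1 i)//= !mxE !eqxx.
rewrite (negbTE (_ : iota i != kap)) 1?eq_sym// !mulr0 !addr0 mulr1.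
rewrite big1 ?addr0// => j ji; rewrite !mxE (inj_eq iota_inj) eq_sym (negbTE ji).
by rewrite mulr0.
Qed.

Lemma assemble_kap (x : 'cV[R]_n) k s : (assemble iota kap x k s).1 kap 0 = k.
Proof.
rewrite /assemble /= raddf_sum /= !mxE summxE !eqxx mulr0 addr0 mulr1.
by rewrite big1 ?add0r// => j _; rewrite !mxE (negbTE (kap_iota j)) mulr0.
Qed.

Lemma assemble_scaling (x : 'cV[R]_n) k s : (assemble iota kap x k s).2 = s.
Proof.
rewrite /assemble /= raddf_sum /= big1 => [|i _].
  by rewrite /GRing.scale /= mulr0 !add0r mulr1.
by rewrite /GRing.scale /= mulr0.
Qed.

Lemma is_derive_assemble (x dx : R -> 'cV[R]_n) (k s : R -> R) (t dk ds : R) (c : state) :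
  (forall i, is_derive t 1 (fun s => x s i 0) (dx t i 0)) ->
  is_derive t 1 k dk -> is_derive t 1 s ds ->
  is_derive t 1 (fun t => assemble iota kap (x t) (k t) (s t) + c)
    (assemble iota kap (dx t) dk ds).
Proof.
move=> x' k' s'; rewrite -[X in is_derive _ _ _ X]addr0.
apply: is_derive_vadd.
apply: is_derive_vadd; last exact: is_derive_fscale.
apply: is_derive_vadd; last exact: is_derive_fscale.
by apply: is_derive_vsum => i; exact: is_derive_fscale.
Qed.

Lemma is_derive_fst_entry (X : R -> state) (t : R) dX j :
  is_derive t 1 X dX -> is_derive t 1 (fun s => (X s).1 j 0) (dX.1 j 0).
Proof.
move=> X'; apply: (is_derive_entry (x := fun s => (X s).1)).
by apply: (is_derive_linear (L := fst)) => // z; exact: cvg_fst.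
Qed.

Lemma is_derive_snd (X : R -> state) (t : R) dX :
  is_derive t 1 X dX -> is_derive t 1 (fun s => (X s).2) dX.2.
Proof. by move=> X'; apply: (is_derive_linear (L := snd)) => // z; exact: cvg_snd. Qed.

Section along_trajectory.
Variables (q v : R -> 'cV[R]_n) (d : 'cV[R]_n).
Local Notation Mt := (fun t => M (q t)).
Local Notation Gt := (fun t => Gam (q t)).
Local Notation mut := (fun t => mu (q t)).
Local Notation dmut := (fun t => grad mu (q t)).
Local Notation dalt := (fun t => grad al (q t)).
Local Notation wt X t := (vh (X t) (q t) - v t).

Let vw X t : v t + wt X t = vh (X t) (q t).
Proof. by rewrite addrC subrK. Qed.

Lemma innovation_gainE X t :
  innovation_gain Mt Gt v dmut mut t (wt X t) (mismatch (X t) (q t)) (obs_scaling (X t)) =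
  gain (X t).
Proof. by rewrite /innovation_gain vw /obs_gain /obs_mismatch /damping_weight addrCA subrr addr0. Qed.

Lemma mismatch_dirE X t :
  mismatch_dir Mt Gt v dmut dalt mut t (wt X t) (mismatch (X t) (q t)) (obs_scaling (X t)) =
  obs_dir iota kap M (X t) (q t).
Proof. by rewrite /mismatch_dir innovation_gainE vw. Qed.

(** True for every [u]: the input force and the potential force are the same in both accelerations
    and cancel in the difference. *)
Lemma error_fieldE X t (u : 'cV[R]_m) :
  error_field Mt Gt v dmut mut d r t (wt X t) (mismatch (X t) (q t)) (obs_scaling (X t)) =
  accel (X t) (q t) u - acceleration M V r (q t) (v t) (G (q t) *m u + d)
    - gain (X t) *: (wt X t).
Proof.
rewrite /error_field innovation_gainE vw; congr (_ - _).
rewrite /obs_accel /acceleration -mulmxBr; congr (_ *m _).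
rewrite mulmxBr; set a := coriolis _ _; set b := coriolis _ _; set e := diag_mx r *m _.
set f := diag_mx r *m _; set g := G _ *m _; set h := grad _ _.
clearbody a b e f g h; apply/colP => i; rewrite !mxE; ring.
Qed.

(** The subtracted expression is the derivative of the target along the motion. The input enters it
    and [gain_rate] through the same product of [vh] and [accel], so it cancels here as well. *)
Lemma mismatch_fieldE X t (u : 'cV[R]_m) :
  mismatch_field Mt Gt v dmut dalt mut t (wt X t) (mismatch (X t) (q t)) (obs_scaling (X t)) =
  gain_rate iota kap M V G r (X t) (q t) u -
  (dot (grad al (q t)) (v t) * (1 + sqn (vh (X t) (q t))) +
   al (q t) * (2 * dot (vh (X t) (q t)) (accel (X t) (q t) u - gain (X t) *: wt X t))).
Proof.
rewrite /mismatch_field mismatch_dirE /gain_rate.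
set S := inertia_bound _ * _ * _; set sg := mismatch _ _.
have -> : dot (obs_dir iota kap M (X t) (q t)) (wt X t) =
   (1 + sqn (vh (X t) (q t))) * dot (grad al (q t)) (wt X t)
   + 2 * al (q t) * gain (X t) * dot (vh (X t) (q t)) (wt X t).
  rewrite /dot !big_distrr -big_split; apply: eq_bigr => i _ /=.
  by rewrite /obs_dir; move: (wt X t) => w; rewrite !mxE; ring.
have -> : dot (vh (X t) (q t)) (accel (X t) (q t) u - gain (X t) *: wt X t) =
    dot (vh (X t) (q t)) (accel (X t) (q t) u)
    - gain (X t) * dot (vh (X t) (q t)) (wt X t) by rewrite [LHS]dotBr dotZr.
by rewrite (dotBr (grad al (q t))); ring.
Qed.

Lemma is_derive_target (y dy : R -> 'cV[R]_n) (t : R) : is_derive t 1 q (v t) ->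
  (forall i, is_derive t 1 (fun s => y s i 0) (dy t i 0)) ->
  is_derive t 1 (fun s => al (q s) * (1 + sqn (y s)))
    (dot (grad al (q t)) (v t) * (1 + sqn (y t)) + al (q t) * (2 * dot (y t) (dy t))).
Proof.
move=> q' y'; apply: is_derive_fmul.
  by apply: is_derive_comp_grad => //; apply: smooth_differentiable; exact: smooth_damping_weight.
by have := is_derive_fadd (is_derive_fcst t 1) (is_derive_sqn y'); rewrite add0r.
Qed.

Lemma observer_error (X : R -> state) (t : R) (u : 'cV[R]_m) :
  is_derive t 1 q (v t) ->
  (forall i, is_derive t 1 (fun s => v s i 0)
     (acceleration M V r (q t) (v t) (G (q t) *m u + d) i 0)) ->
  is_derive t 1 X (obs (X t, q t, u)) ->
  [/\ forall i, is_derive t 1 (fun s => (wt X s) i 0)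
        (error_field Mt Gt v dmut mut d r t (wt X t) (mismatch (X t) (q t)) (obs_scaling (X t)) i 0),
      is_derive t 1 (fun s => mismatch (X s) (q s))
        (mismatch_field Mt Gt v dmut dalt mut t (wt X t) (mismatch (X t) (q t)) (obs_scaling (X t))) &
      is_derive t 1 (fun s => obs_scaling (X s))
        (obs_scaling (X t) * (1 + mismatch (X t) (q t) ^+ 2))].
Proof.
move=> q' v' X'.
have xi' i := is_derive_fst_entry (iota i) X'.
have k' := is_derive_fst_entry kap X'; have s' := is_derive_snd X'.
rewrite assemble_scaling in s'; rewrite assemble_kap in k'.
have {}xi' i : is_derive t 1 (fun s => (X s).1 (iota i) 0) (offset_rate iota kap M V G r (X t) (q t) u i 0).
  by have := xi' i; rewrite assemble_iota.
have rho' : is_derive t 1 (fun s => obs_scaling (X s)) (scaling_rate iota kap M (X t) (q t)).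
  by have := is_derive_fadd (is_derive_fcst t 1) s'; rewrite add0r.
have gain' : is_derive t 1 (fun s => gain (X s)) (total_gain_rate iota kap M V G r (X t) (q t) u).
  exact: is_derive_fadd k' (is_derive_fsqr rho').
pose dvh (t : R) := accel (X t) (q t) u - gain (X t) *: wt X t.
have vh' i : is_derive t 1 (fun s => vh (X s) (q s) i 0) (dvh t i 0).
  have := is_derive_fadd (xi' i) (is_derive_fmul gain' (is_derive_entry i 0 q')).
  rewrite (_ : (fun s => _ + _) = (fun s => vh (X s) (q s) i 0)); last first.
    by apply/funext => s; rewrite !mxE.
  rewrite (_ : _ + _ = dvh t i 0)//; rewrite /dvh /offset_rate.
  set a := obs_accel _ _ _ _ _ _ _ _ _; set b := vh _ _.
  by rewrite !mxE; ring.
split=> //.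
- move=> i; have := is_derive_fsub (vh' i) (v' i).
  rewrite (_ : (fun s => _ - _) = (fun s => (wt X s) i 0)); last first.
    by apply/funext => s; rewrite [in RHS]mxE [X in _ = _ + X]mxE.
  rewrite (_ : _ - _ =
    error_field Mt Gt v dmut mut d r t (wt X t) (mismatch (X t) (q t)) (obs_scaling (X t)) i 0)//.
  rewrite (error_fieldE X t u) /dvh; set a := obs_accel _ _ _ _ _ _ _ _ _; set b := acceleration _ _ _ _ _ _.
  by set w := wt X t; clearbody a b w; rewrite !mxE; ring.
- have := is_derive_fsub k' (is_derive_target q' vh').
  rewrite (_ : _ - _ =
    mismatch_field Mt Gt v dmut dalt mut t (wt X t) (mismatch (X t) (q t)) (obs_scaling (X t)))//.
  by rewrite (mismatch_fieldE X t u).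
Qed.

(** * From solutions of the error system to observer states *)

Section state_of_error.
Variables (w : R -> 'cV[R]_n) (sg rho : R -> R) (c : state).
Hypothesis c_iota : forall i, c.1 (iota i) 0 = 0.
Hypothesis c_kap : c.1 kap 0 = 0.
Hypothesis c_scaling : c.2 = 0.

Let y t := v t + w t.
Let k t := al (q t) * (1 + sqn (y t)) + sg t.
Let g t := k t + rho t ^+ 2.
Let x t := y t - g t *: q t.

(* [c] carries the idle entries of the observer state. *)
Definition state_of_error t : state := assemble iota kap (x t) (k t) (rho t - 1) + c.
Local Notation X := state_of_error.

Let X_iota t i : (X t).1 (iota i) 0 = x t i 0.
Proof. by rewrite mxE c_iota addr0 assemble_iota. Qed.

Let X_kap t : (X t).1 kap 0 = k t.
Proof. by rewrite mxE c_kap addr0 assemble_kap. Qed.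

Lemma state_of_error_scaling t : obs_scaling (X t) = rho t.
Proof.
rewrite /obs_scaling.
have -> : (X t).2 = (assemble iota kap (x t) (k t) (rho t - 1)).2 + c.2 by [].
by rewrite c_scaling addr0 assemble_scaling addrC subrK.
Qed.

Let X_gain t : gain (X t) = g t.
Proof. by rewrite /obs_gain X_kap state_of_error_scaling. Qed.

Lemma state_of_error_velocity t : vh (X t) (q t) = v t + w t.
Proof.
rewrite /obs_velocity X_gain; apply/colP => i; rewrite mxE [obs_offset _ _ _ _]mxE X_iota.
by rewrite /x !mxE subrK.
Qed.

Let X_mismatch t : mismatch (X t) (q t) = sg t.
Proof. by rewrite /obs_mismatch X_kap state_of_error_velocity addrC addKr. Qed.

Let X_error t : wt X t = w t.
Proof. by rewrite state_of_error_velocity addrC addKr. Qed.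

(** Converse of [observer_error]. It carries existence from the error system, where [u] is absent,
    to the observer driven by a [u] of unknown regularity. *)
Lemma error_observer (t : R) (u : 'cV[R]_m) :
  is_derive t 1 q (v t) ->
  (forall i, is_derive t 1 (fun s => v s i 0)
     (acceleration M V r (q t) (v t) (G (q t) *m u + d) i 0)) ->
  (forall i, is_derive t 1 (fun s => w s i 0)
     (error_field Mt Gt v dmut mut d r t (w t) (sg t) (rho t) i 0)) ->
  is_derive t 1 sg (mismatch_field Mt Gt v dmut dalt mut t (w t) (sg t) (rho t)) ->
  is_derive t 1 rho (rho t * (1 + sg t ^+ 2)) ->
  is_derive t 1 X (obs (X t, q t, u)).
Proof.
move=> q' v' w' sg' rho'.
have eF := error_fieldE X t u; rewrite X_error X_mismatch state_of_error_scaling in eF.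
have mF := mismatch_fieldE X t u; rewrite X_error X_mismatch state_of_error_scaling in mF.
pose dy (t : R) := accel (X t) (q t) u - gain (X t) *: w t.
have y' i : is_derive t 1 (fun s => y s i 0) (dy t i 0).
  have := is_derive_fadd (v' i) (w' i).
  rewrite (_ : (fun s => _ + _) = (fun s => y s i 0)); last by apply/funext => s; rewrite mxE.
  rewrite (_ : _ + _ = dy t i 0)// eF /dy.
  set a := obs_accel _ _ _ _ _ _ _ _ _; set b := acceleration _ _ _ _ _ _.
  by clearbody a b; rewrite !mxE; ring.
have k' : is_derive t 1 k (gain_rate iota kap M V G r (X t) (q t) u).
  have := is_derive_fadd (is_derive_target q' y') sg'.
  rewrite (_ : _ + mismatch_field _ _ _ _ _ _ _ _ _ _ = gain_rate iota kap M V G r (X t) (q t) u)//.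
  by rewrite mF state_of_error_velocity /dy; ring.
have rho'' : is_derive t 1 rho (scaling_rate iota kap M (X t) (q t)).
  by rewrite /scaling_rate X_mismatch state_of_error_scaling.
have g' : is_derive t 1 g (total_gain_rate iota kap M V G r (X t) (q t) u).
  by rewrite /total_gain_rate state_of_error_scaling; exact: is_derive_fadd k' (is_derive_fsqr rho'').
apply: (@is_derive_assemble x (fun t => offset_rate iota kap M V G r (X t) (q t) u)
  k (fun t => rho t - 1) t _ _ c _ k' _).
- move=> i; have := is_derive_fsub (y' i) (is_derive_fmul g' (is_derive_entry i 0 q')).
  rewrite (_ : (fun s => _ - _) = (fun s => x s i 0)); last first.
    by apply/funext => s; rewrite !mxE.
  rewrite (_ : _ - _ = offset_rate iota kap M V G r (X t) (q t) u i 0)//.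
  rewrite /offset_rate /dy X_gain state_of_error_velocity.
  set a := obs_accel _ _ _ _ _ _ _ _ _; clearbody a.
  by rewrite !mxE; ring.
- by have := is_derive_fsub rho'' (is_derive_fcst t 1); rewrite subr0.
Qed.

End state_of_error.

End along_trajectory.
End observer_dynamics.

(** * Convergence *)

Lemma cvg_cV0 (R : realType) (n : nat) (f : R -> 'cV[R]_n) :
  (forall i, f t i 0 @[t --> +oo] --> (0 : R)) -> f t @[t --> +oo] --> (0 : 'cV[R]_n).
Proof.
move=> fi; apply/cvgrPdist_le => e e0.
have : \forall t \near +oo, forall i, `|f t i 0| <= e.
  apply: filter_forall => i; have /cvgrPdist_le/(_ e e0) := fi i.
  by apply: filterS => t; rewrite sub0r normrN.
apply: filterS => t ft; rewrite sub0r normrN [leLHS]/Num.Def.normr/= mx_normrE.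
by apply: (bigmax_le _ (ltW e0)) => -[i j] _ /=; rewrite ord1.
Qed.

Section convergence.
Context {R : realType} {n m N : nat}.
Variables (iota : 'I_n -> 'I_N) (kap : 'I_N).
Hypothesis iota_inj : injective iota.
Hypothesis kap_iota : forall i, kap != iota i.
Variables (M : 'cV[R]_n -> 'M[R]_n) (V : 'cV[R]_n -> R) (G : 'cV[R]_n -> 'M[R]_(n, m)).
Variable r : 'rV[R]_n.
Hypothesis M_smooth : smooth M.
Hypothesis V_smooth : smooth V.
Hypothesis Mp : forall q, sym_posdef (M q).
Hypothesis r0 : forall i, 0 <= r 0 i.
Local Notation state := ('cV[R]_N * R)%type.
Local Notation P q := (invmx (M q)).
Local Notation obs := (observer iota kap M V G r).

Variables (d : 'cV[R]_n) (u : R -> 'cV[R]_m) (q p : R -> 'cV[R]_n).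
Hypothesis qp : mech_trajectory M V G r d u q p.

(** The extension to negative times gives two-sided derivatives at 0, so the product and chain rules
    apply on all of [t >= 0], and continuity on the whole line, as [error_exists] requires. *)
Lemma mech_trajectory_extension : exists Q S : R -> 'cV[R]_n,
  [/\ continuous Q, continuous S,
      forall t : R, 0 <= t -> Q t = q t /\ S t = p t,
      forall t : R, 0 <= t -> is_derive t 1 Q (P (Q t) *m S t) &
      forall t : R, 0 <= t -> forall i, is_derive t 1 (fun s => (P (Q s) *m S s) i 0)
        (acceleration M V r (Q t) (P (Q t) *m S t) (G (Q t) *m u t + d) i 0)].
Proof.
have [/solves_is_derive[Q [cQ QE Q']] /solves_is_derive[S [cS SE S']]] := qp.
exists Q, S; split => // [t t0|t t0|t t0].
- by rewrite QE// SE.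
- by have := Q' t t0; rewrite -QE// -SE// grad_hamiltonian_p.
- apply: is_derive_velocity => //; first by rewrite QE// SE//; exact: Q'.
  by have := S' t t0; rewrite -!addrA QE// SE.
Qed.

Lemma observer_exists (X0 : state) : 0 <= X0.2 -> exists X : R -> state,
  [/\ X 0 = X0, forall t : R, 0 <= t -> 0 <= (X t).2 &
    forall t : R, 0 <= t -> is_derive t 1 X (obs (X t, q t, u t))].
Proof.
move=> X00; have [Q [S [cQ cS QS Q' v']]] := mech_trajectory_extension.
pose v t := P (Q t) *m S t.
have cf (f : 'cV[R]_n -> R) : smooth f -> continuous (fun t => f (Q t)).
  move=> sf t; apply: (@continuous_comp _ _ _ Q f); first exact: cQ.
  by apply: differentiable_continuous; exact: smooth_differentiable.
have cSi j : continuous (fun t => S t j 0).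
  move=> t; apply: (@continuous_comp _ _ _ S (fun x : 'cV[R]_n => x j 0)); first exact: cS.
  exact: coord_continuous.
have cP i j : continuous (fun t => P (Q t) i j).
  by apply: (cf (fun z => P z i j)); exact: smooth_P_entry.
have cv i : continuous (fun t => v t i 0).
  under eq_fun do rewrite /v mxE.
  move=> t; apply: cvg_big => [|j _]; first exact: add_continuous.
  by apply: cvgM; [exact: cP|exact: cSi].
have rho1 : 1 <= obs_scaling X0 by rewrite lerDl.
have [w [sg [rho [w0 sg0 rho0 sol]]]] := @error_exists R n (fun t => M (Q t))
  (fun t => inertia_derivative M (Q t)) v (fun t => grad (inertia_trace M) (Q t))
  (fun t => grad (damping_weight M) (Q t)) (fun t => inertia_trace M (Q t)) d r
  (fun t => Mp (Q t)) (fun t => inertia_derivative_sym Mp (Q t)) r0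
  (fun t => ler_wpDr (posdef_tr_ge0 (Mp (Q t))) (lexx 1))
  (fun t i j t0 => is_derive_inertia M_smooth i j (Q' t t0)) cP
  (fun l i j => cf _ (smooth_inertia_derivative M_smooth l i j)) cv
  (fun i => cf _ (vsmooth_grad (smooth_damping_weight M_smooth Mp) i))
  (cf _ (smooth_damping_weight M_smooth Mp))
  (obs_velocity iota kap X0 (Q 0) - v 0) (obs_mismatch iota kap M X0 (Q 0))
  (obs_scaling X0) rho1.
(* The observer field vanishes on the idle entries, so they keep their initial values for all
   time. *)
pose c : state := X0 - assemble iota kap (obs_offset iota X0) (X0.1 kap 0) X0.2.
have c_iota i : c.1 (iota i) 0 = 0.
  by rewrite mxE [X in _ + X]mxE assemble_iota// mxE subrr.
have c_kap : c.1 kap 0 = 0 by rewrite mxE [X in _ + X]mxE assemble_kap// subrr.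
have c_s : c.2 = 0.
  have -> : c.2 = X0.2 - (assemble iota kap (obs_offset iota X0) (X0.1 kap 0) X0.2).2 by [].
  by rewrite assemble_scaling subrr.
pose X := state_of_error iota kap M Q v w sg rho c.
have tT (t : R) : 0 <= t -> 0 <= t < t + 1 by move=> ->; rewrite ltrDl ltr01.
exists X; split.
- rewrite /X /state_of_error w0 sg0 rho0 addrC /c.
  have -> : v 0 + (obs_velocity iota kap X0 (Q 0) - v 0) = obs_velocity iota kap X0 (Q 0).
    by rewrite addrC subrK.
  have -> : damping_weight M (Q 0) * (1 + sqn (obs_velocity iota kap X0 (Q 0))) +
      obs_mismatch iota kap M X0 (Q 0) = X0.1 kap 0 by rewrite /obs_mismatch addrC subrK.
  have -> : obs_scaling X0 - 1 = X0.2 by rewrite /obs_scaling addrC addKr.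
  have -> : obs_velocity iota kap X0 (Q 0) - (X0.1 kap 0 + obs_scaling X0 ^+ 2) *: Q 0 =
      obs_offset iota X0 by rewrite /obs_velocity addrK.
  by rewrite subrK.
- move=> t t0.
  have [_ _ rho'] := sol (t + 1).
  have rr : 1 <= rho 0 by rewrite rho0.
  have := scaling_ge1 rr rho' (tT t t0).
  rewrite -(state_of_error_scaling iota kap M Q v w sg rho c_s t) -/X /obs_scaling.
  by rewrite lerDl.
- move=> t t0; have [w' sg' rho'] := sol (t + 1); have [<- _] := QS t t0.
  have tt := tT t t0.
  exact: (error_observer iota_inj kap_iota M_smooth Mp c_iota c_kap c_s (Q' t t0)
    (v' t t0) (w' t tt) (sg' t tt) (rho' t tt)).
Qed.

Lemma observer_converges (X : R -> state) : 0 <= (X 0).2 ->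
  solves X (fun t => obs (X t, q t, u t)) ->
  momentum_estimate iota kap M (X t, q t) - p t @[t --> +oo] --> (0 : 'cV[R]_n).
Proof.
move=> X00 /solves_is_derive[Y [_ YX Y']].
have [Q [S [cQ cS QS Q' v']]] := mech_trajectory_extension.
pose v t := P (Q t) *m S t; pose w t := obs_velocity iota kap (Y t) (Q t) - v t.
have {}Y' (t : R) : 0 <= t -> is_derive t 1 Y (obs (Y t, Q t, u t)).
  by move=> t0; have := Y' t t0; rewrite -YX//; have [-> _] := QS t t0.
have err t (t0 : 0 <= t) := @observer_error R n m N iota kap iota_inj kap_iota M V G r
  M_smooth Mp Q v d Y t (u t) (Q' t t0) (v' t t0) (Y' t t0).
have sol T : error_solution (fun t => M (Q t))
  (fun t => inertia_derivative M (Q t)) v (fun t => grad (inertia_trace M) (Q t))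
  (fun t => grad (damping_weight M) (Q t)) (fun t => inertia_trace M (Q t)) d r T w
  (fun t => obs_mismatch iota kap M (Y t) (Q t)) (fun t => obs_scaling (Y t)).
  split=> t /andP[t0 _]; by have [] := err t t0.
have rho1 : 1 <= obs_scaling (Y 0) by rewrite lerDl YX.
have mu' (t : R) : 0 <= t -> is_derive t 1 (fun t => inertia_trace M (Q t))
    (dot (grad (inertia_trace M) (Q t)) (v t)).
  move=> t0; apply: is_derive_comp_grad (Q' t t0).
  by apply: smooth_differentiable; exact: smooth_inertia_trace.
have muM t : \tr (M (Q t)) <= inertia_trace M (Q t) by rewrite lerDr.
have H := error_cvg (fun t => Mp (Q t)) (fun t => inertia_derivative_sym Mp (Q t)) r0
  (fun t => ler_wpDr (posdef_tr_ge0 (Mp (Q t))) (lexx 1)) muM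
  (fun t i j t0 => is_derive_inertia M_smooth i j (Q' t t0)) mu' rho1 sol.
apply: cvg_trans (cvg_cV0 H); apply: near_eq_cvg; near=> t.
have t0 : 0 <= t by near: t; apply: nbhs_pinfty_ge; exact: num_real.
have [<- <-] := QS t t0; rewrite /momentum_estimate /= -YX// /w mulmxBr.
by rewrite /v mulmxA posdef_mulV// mul1mx.
Unshelve. all: by end_near. Qed.

End convergence.

Theorem proposition2 (R : realType) (n m : nat)
    (M : 'cV[R]_n -> 'M[R]_n) (V : 'cV[R]_n -> R) (G : 'cV[R]_n -> 'M[R]_(n, m))
    (r : 'rV[R]_n)
    (M_smooth : smooth_on setT M) (V_smooth : smooth_on setT V)
    (G_smooth : smooth_on setT G)
    (M_posdef : forall q, sym_posdef (M q)) (r_ge0 : forall i, 0 <= r 0 i) :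
  exists (A : ostate R n * 'cV[R]_n * 'cV[R]_m -> ostate R n)
         (B : ostate R n * 'cV[R]_n -> 'cV[R]_n),
    [/\ smooth_on [set z | in_ostate z.1.1] A,
        smooth_on [set z | in_ostate z.1] B &
        forall (d : 'cV[R]_n) (u : R -> 'cV[R]_m) (q p : R -> 'cV[R]_n),
          mech_trajectory M V G r d u q p ->
          forall X0 : ostate R n, in_ostate X0 ->
            (exists2 X : R -> ostate R n,
               observer_trajectory A q u X & X 0 = X0) /\
            (forall X : R -> ostate R n,
               observer_trajectory A q u X -> X 0 = X0 ->
               B (X t, q t) - p t @[t --> +oo] --> (0 : 'cV[R]_n))].
Proof.
(* When [n = 0] there is no entry left for the gain state. *)
case: n => [|n] in M V G r M_smooth V_smooth G_smooth M_posdef r_ge0 *.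
  exists (fun=> 0), (fun=> 0); split; [exact/smooth_smooth_on/smooth_cst|exact/smooth_smooth_on/smooth_cst|].
  move=> d u q p _ X0 X00; split.
    exists (fun=> X0) => //; split=> //.
    by apply: is_derive_solves => t _; exact: (is_derive_cst X0 t 1).
  move=> X _ _; rewrite (_ : (fun t => _) = fun=> 0); first exact: cvg_cst.
  by apply/funext => t; rewrite flatmx0.
have n4 : (n.+1 < 4 * n.+1)%N by rewrite -[X in (X < _)%N]mul1n ltn_mul2r.
(* The offset occupies the first [n.+1] entries of the state, and the gain state the entry right
   after them. *)
pose iota (i : 'I_n.+1) := widen_ord (ltnW n4) i; pose kap := Ordinal n4.
have iota_inj : injective iota by move=> i j /(congr1 val) /= /val_inj.
have kap_iota i : kap != iota i by rewrite -val_eqE /= gtn_eqF.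
have sM := smooth_on_setT M_smooth; have sV := smooth_on_setT V_smooth.
have sG := smooth_on_setT G_smooth.
exists (observer iota kap M V G r), (momentum_estimate iota kap M); split.
- exact/smooth_smooth_on/smooth_observer.
- exact/smooth_smooth_on/smooth_estimate.
move=> d u q p qp X0 X00; split.
  have [X [XX0 X2 X']] := observer_exists iota_inj kap_iota sM sV M_posdef r_ge0 qp X00.
  by exists X => //; split=> //; exact: is_derive_solves.
move=> X [X2 X'] XX0; apply: (observer_converges iota_inj kap_iota sM sV M_posdef r_ge0 qp) => //.
exact: X2.
Qed.
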